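(* Let $A$ be a finite alphabet of size at least $2$ and let $k$ be a positive integer. Then, with respect to either the sum length stratification or the maximum length stratification, the monoid defined by the generic $A$-generated $k$-relation monoid presentation is rational (in the sense of Sakarovitch), asynchronous automatic, and word hyperbolic (in the sense of Duncan and Gilman). It also satisfies an analogue of Kleene's theorem, has a boolean algebra of rational subsets, and has decidable rational subset membership problem.
   Context: An $A$-generated $k$-relation monoid presentation consists of the finite alphabet $A$ and a finite sequence $R$ of $k$ ordered pairs of words in $A^*$; it defines the monoid $A^*/\equiv_R$, where $\equiv_R$ is the congruence on $A^*$ generated by $R$. The relation words are the $2k$ words occurring as sides of the relations. Let $S$ be the set of all such presentations. The sum length (respectively, maximum length) stratification of $S$ is the sequence $(S_n)$ where $S_n$ is the finite set of presentations in $S$ whose sum of relation word lengths (respectively, length of longest relation word) is exactly $n$. A subset $X\subseteq S$ is generic if $\lim_{n\to\infty}|X\cap S_n|/|S_n|=1$. ''The generic presentation has property $Y$'' means that there is a generic subset of $S$ every member of which has property $Y$. Let $M$ be a finitely generated monoid. The rational subsets of a monoid are the members of the smallest family containing the finite subsets and closed under finite union, product and generation of submonoids. A relation between free monoids $B^*$ and $C^*$ is rational if it is a rational subset of $B^*\times C^*$ (equivalently, accepted by an asynchronous two-tape finite automaton). - $M$ is rational if there are a finite alphabet $B$, a surjective morphism $\sigma:B^*\to M$ and a function $\beta:B^*\to B^*$ whose graph is a rational relation, such that $\sigma(\beta(w))=\sigma(w)$ for all $w$, and $\beta(u)=\beta(v)$ whenever $\sigma(u)=\sigma(v)$. - $M$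 is asynchronous automatic if there are a finite alphabet $B$, a surjective morphism $\sigma:B^*\to M$ and a regular language $L\subseteq B^*$ with $\sigma(L)=M$ such that $\{(u,v)\in L\times L: \sigma(u)=\sigma(v)\}$ and, for each $b\in B$, $\{(u,v)\in L\times L:\sigma(ub)=\sigma(v)\}$ are rational relations. - $M$ is word hyperbolic if there are a finite alphabet $B$, a surjective morphism $\sigma:B^*\to M$ and a regular language $L\subseteq B^*$ with $\sigma(L)=M$ such that, with $\#\notin B$ and $w^{\mathrm{rev}}$ the reverse of $w$, the language $\{u\#v\#w^{\mathrm{rev}}: u,v,w\in L,\ \sigma(u)\sigma(v)=\sigma(w)\}$ is context-free. - $M$ satisfies an analogue of Kleene's theorem if a subset of $M$ is rational if and only if it is recognisable, i.e. is the preimage of a subset of a finite monoid under a morphism from $M$. - $M$ has a boolean algebra of rational subsets if its rational subsets are closed under union, intersection and complement. - $M$ has decidable rational subset membership problem if, for a finite generating set $B$ with surjective morphism $\sigma:B^*\to M$, there is an algorithm which, given a finite automaton over $B$ accepting a language $K$ and a word $w\in B^*$, decides whether $\sigma(w)\in\sigma(K)$. *)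

(* Defs.v *)
From HB Require Import structures.
From Stdlib Require Import Relation_Operators.
From mathcomp Require Import all_boot all_order all_algebra.
From mathcomp Require Import finmap.
From mathcomp Require Import all_classical all_reals.
From mathcomp Require Import topology normedtype sequences.

Set Implicit Arguments.
Unset Strict Implicit.
Unset Printing Implicit Defensive.

Import Order.TTheory GRing.Theory Num.Theory.
Import numFieldNormedType.Exports.

Local Open Scope classical_set_scope.
Local Open Scope quotient_scope.

Definition word (A : choiceType) : Type := seq A.

HB.instance Definition _ (A : choiceType) := Choice.copy (word A) (seq A).
HB.instance Definition _ (A : choiceType) :=
  isMonoid.Build (word A) (@catA A) (@cat0s A) (@cats0 A).

Definition presentation (A : finType) (k : nat) : Type :=
  k.-tuple (word A * word A)%type.

HB.instance Definition _ (A : finType) (k : nat) :=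
  Choice.copy (presentation A k) (k.-tuple (word A * word A)%type).

Inductive pres_cong (A : finType) (k : nat) (p : presentation A k) :
    word A -> word A -> Prop :=
| pres_cong_rel u v : (u, v) \in val p -> pres_cong p u v
| pres_cong_refl u : pres_cong p u u
| pres_cong_sym u v : pres_cong p u v -> pres_cong p v u
| pres_cong_trans u v w :
    pres_cong p u v -> pres_cong p v w -> pres_cong p u w
| pres_cong_mul u u' v v' :
    pres_cong p u u' -> pres_cong p v v' -> pres_cong p (u * v)%g (u' * v')%g.

Section PresentedMonoid.
Variables (A : finType) (k : nat) (p : presentation A k).

Definition pres_congb : rel (word A) := fun u v => `[< pres_cong p u v >].

Lemma pres_congb_refl : reflexive pres_congb.
Proof. by move=> u; apply/asboolP/pres_cong_refl. Qed.

Lemma pres_congb_sym : symmetric pres_congb.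
Proof.
by move=> u v; apply/asboolP/asboolP => h; apply: pres_cong_sym.
Qed.

Lemma pres_congb_trans : transitive pres_congb.
Proof.
move=> v u w /asboolP uv /asboolP vw.
exact/asboolP/(pres_cong_trans uv vw).
Qed.

Canonical pres_equiv :=
  EquivRel pres_congb pres_congb_refl pres_congb_sym pres_congb_trans.

Definition pres_monoid : Type := {eq_quot pres_equiv}.
HB.instance Definition _ := Choice.copy pres_monoid {eq_quot pres_equiv}.

Definition pres_pi (u : word A) : pres_monoid := \pi_{eq_quot pres_equiv} u.

Lemma pres_piP u v : pres_pi u = pres_pi v <-> pres_cong p u v.
Proof.
by split=> [/eqmodP/asboolP //|h]; apply/eqmodP/asboolP.
Qed.

Definition pres_mul (x y : pres_monoid) : pres_monoid :=
  pres_pi (repr x * repr y)%g.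
Definition pres_one : pres_monoid := pres_pi 1%g.

Lemma pres_repr (x : pres_monoid) : pres_pi (repr x) = x.
Proof. exact: reprK. Qed.

Lemma pres_pi_mul u v : pres_mul (pres_pi u) (pres_pi v) = pres_pi (u * v)%g.
Proof.
by apply/pres_piP/pres_cong_mul; apply/pres_piP; rewrite pres_repr.
Qed.

Lemma pres_mulA : associative pres_mul.
Proof.
move=> x y z; rewrite -(pres_repr x) -(pres_repr y) -(pres_repr z).
by rewrite !pres_pi_mul mulgA.
Qed.

Lemma pres_mul1 : left_id pres_one pres_mul.
Proof. by move=> x; rewrite -(pres_repr x) pres_pi_mul mul1g. Qed.

Lemma pres_mulr1 : right_id pres_one pres_mul.
Proof. by move=> x; rewrite -(pres_repr x) pres_pi_mul mulg1. Qed.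

HB.instance Definition _ :=
  isMonoid.Build pres_monoid pres_mulA pres_mul1 pres_mulr1.

Lemma pres_pi_morphism : monoid.monoid_morphism pres_pi.
Proof. by split=> // u v; rewrite -pres_pi_mul. Qed.

Lemma pres_pi_surj (x : pres_monoid) : exists u, pres_pi u = x.
Proof. by exists (repr x); exact: pres_repr. Qed.

End PresentedMonoid.

Definition sum_length (A : finType) (k : nat) (p : presentation A k) : nat :=
  \sum_(r <- val p) (size r.1 + size r.2).

Definition max_length (A : finType) (k : nat) (p : presentation A k) : nat :=
  \max_(r <- val p) maxn (size r.1) (size r.2).

Definition stratum (A : finType) (k : nat) (len : presentation A k -> nat)
  (n : nat) : set (presentation A k) := [set p | len p = n].

(* [fset_set] is only meaningful on finite sets; the strata are finite by
   [finite_stratum_sum] and [finite_stratum_max] below. *)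
Definition generic (R : realType) (A : finType) (k : nat)
    (len : presentation A k -> nat) (X : set (presentation A k)) : Prop :=
  (fun n => (#|` fset_set (X `&` stratum len n)|%:R /
             #|` fset_set (stratum len n)|%:R)%R : R) @ \oo --> (1%R : R).

Definition generic_presentation_has (R : realType) (A : finType) (k : nat)
    (len : presentation A k -> nat) (Y : presentation A k -> Prop) : Prop :=
  exists X : set (presentation A k), generic R len X /\ forall p, X p -> Y p.

Lemma finite_presentation_le (A : finType) (k n : nat) :
  finite_set [set p : presentation A k | (max_length p <= n)%N].
Proof.
pose W : finType := {i : 'I_n.+1 & i.-tuple A}.
pose f (t : {ffun 'I_k -> W * W}) : presentation A k :=
  [tuple (val (tagged (t i).1) : word A, val (tagged (t i).2) : word A)
    | i < k].
apply: (sub_finite_set _ (finite_image f (@finite_finset _ setT))) => p /= hp.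
have hw (i : 'I_k) :
    (size (tnth p i).1 <= n)%N /\ (size (tnth p i).2 <= n)%N.
  have: (maxn (size (tnth p i).1) (size (tnth p i).2) <= n)%N.
    apply: leq_trans hp; rewrite /max_length.
    by apply: (leq_bigmax_seq (F := fun r => maxn (size r.1) (size r.2))) => //;
      exact: mem_tnth.
  by rewrite geq_max => /andP.
pose g (w : word A) (h : (size w <= n)%N) : W :=
  existT (fun i : 'I_n.+1 => i.-tuple A)
    (Ordinal (h : (size w < n.+1)%N)) (in_tuple w).
exists [ffun i => (g _ (hw i).1, g _ (hw i).2)] => //.
by apply: eq_from_tnth => i; rewrite tnth_mktuple ffunE /= -surjective_pairing.
Qed.

Lemma finite_stratum_max (A : finType) (k n : nat) :
  finite_set (stratum (@max_length A k) n).
Proof.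
apply: sub_finite_set (finite_presentation_le A k n) => p /= ->.
exact: leqnn.
Qed.

Lemma finite_stratum_sum (A : finType) (k n : nat) :
  finite_set (stratum (@sum_length A k) n).
Proof.
apply: sub_finite_set (finite_presentation_le A k n) => p /= <-.
rewrite /max_length /sum_length; elim: (val p) => [|r s IH].
  by rewrite !big_nil.
rewrite !big_cons; apply: leq_trans (leq_add (leqnn _) IH).
rewrite !geq_max leq_addl -addnA leq_addr /=.
by rewrite andbT addnCA leq_addr.
Qed.

Section Subsets.
Variable M : monoidType.

Definition submonoid (X : set M) : Prop :=
  X 1%g /\ forall x y, X x -> X y -> X (x * y)%g.

Inductive rational_subset : set M -> Prop :=
| rational_finite X : finite_set X -> rational_subset X
| rational_union X Y :
    rational_subset X -> rational_subset Y -> rational_subset (X `|` Y)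
| rational_product X Y :
    rational_subset X -> rational_subset Y ->
    rational_subset [set (x * y)%g | x in X & y in Y]
| rational_submonoid X :
    rational_subset X -> rational_subset (smallest submonoid X).

Definition recognisable (X : set M) : Prop :=
  exists (F : monoidType) (phi : M -> F) (P : set F),
    [/\ finite_set [set: F], monoid.monoid_morphism phi & X = phi @^-1` P].

Definition kleene_analogue : Prop :=
  forall X : set M, rational_subset X <-> recognisable X.

Definition boolean_algebra_of_rational_subsets : Prop :=
  [/\ forall X Y, rational_subset X -> rational_subset Y ->
        rational_subset (X `|` Y),
      forall X Y, rational_subset X -> rational_subset Y ->
        rational_subset (X `&` Y)
    & forall X, rational_subset X -> rational_subset (~` X)].

End Subsets.

Definition rational_relation (B C : choiceType)
    (r : word B -> word C -> Prop) : Prop :=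
  rational_subset [set uv : word B * word C | r uv.1 uv.2].

(* A nondeterministic finite automaton: the states are the natural numbers
   occurring in the three lists, and [(s, b, t)] in [nfa_trans] is a transition
   from [s] to [t] reading [b]. *)
Record nfa (B : choiceType) : Type := Nfa {
  nfa_init : seq nat;
  nfa_final : seq nat;
  nfa_trans : seq (nat * B * nat)
}.

Fixpoint nfa_accepts_from (B : choiceType) (N : nfa B) (s : nat) (w : seq B)
    : bool :=
  if w is b :: w' then
    has (fun t => (t.1 == (s, b)) && nfa_accepts_from N t.2 w') (nfa_trans N)
  else s \in nfa_final N.

Definition nfa_language (B : choiceType) (N : nfa B) : set (word B) :=
  [set w | has (fun s => nfa_accepts_from N s w) (nfa_init N)].

Definition regular (B : choiceType) (L : set (word B)) : Prop :=
  exists N : nfa B, L = nfa_language N.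

Record cfg (T : eqType) : Type := Cfg {
  cfg_nonterminal : finType;
  cfg_start : cfg_nonterminal;
  cfg_rules : seq (cfg_nonterminal * seq (cfg_nonterminal + T))
}.

Inductive cfg_step (T : eqType) (G : cfg T) :
    seq (cfg_nonterminal G + T) -> seq (cfg_nonterminal G + T) -> Prop :=
| Cfg_step x y N rhs : (N, rhs) \in cfg_rules G ->
    cfg_step (x ++ inl N :: y) (x ++ rhs ++ y).

Definition cfg_language (T : eqType) (G : cfg T) : set (seq T) :=
  [set w | clos_refl_trans _ (@cfg_step T G)
             [:: inl (cfg_start G)] (map inr w)].

Definition context_free (T : eqType) (L : set (seq T)) : Prop :=
  exists G : cfg T, L = cfg_language G.

Definition surjective_morphism (M N : monoidType) (f : M -> N) : Prop :=
  monoid.monoid_morphism f /\ forall y, exists x, f x = y.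

Definition rational_monoid (M : monoidType) : Prop :=
  exists (B : finType) (sigma : word B -> M) (beta : word B -> word B),
    [/\ surjective_morphism sigma,
        rational_relation (fun u v => v = beta u),
        forall w, sigma (beta w) = sigma w
      & forall u v, sigma u = sigma v -> beta u = beta v].

Definition asynchronous_automatic (M : monoidType) : Prop :=
  exists (B : finType) (sigma : word B -> M) (L : set (word B)),
    [/\ surjective_morphism sigma, regular L, sigma @` L = [set: M],
        rational_relation (fun u v => [/\ L u, L v & sigma u = sigma v])
      & forall b : B, rational_relation
          (fun u v => [/\ L u, L v & sigma (u * [:: b] : word B)%g = sigma v])].

(* The separator # is [None : option B]. *)
Definition multiplication_language (M : monoidType) (B : finType)
    (sigma : word B -> M) (L : set (word B)) : set (seq (option B)) :=
  [set x | exists u v w : word B,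
     [/\ L u, L v, L w, (sigma u * sigma v)%g = sigma w
       & x = map Some u ++ None :: map Some v ++ None :: map Some (rev w)]].

Definition word_hyperbolic (M : monoidType) : Prop :=
  exists (B : finType) (sigma : word B -> M) (L : set (word B)),
    [/\ surjective_morphism sigma, regular L, sigma @` L = [set: M]
      & context_free (multiplication_language sigma L)].

(* Decidability is a statement about programs, since classically every
   predicate has a boolean characteristic function.  The programming language
   is Jones's Turing-complete language WHILE, whose data are binary trees.  A
   program reads its input in variable 0, all other variables being [Leaf], and
   leaves its output in variable 0. *)
Inductive tree : Type := Leaf | Node of tree & tree.

Fixpoint tree_eqb (s t : tree) : bool :=
  match s, t with
  | Leaf, Leaf => true
  | Node s1 s2, Node t1 t2 => tree_eqb s1 t1 && tree_eqb s2 t2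
  | _, _ => false
  end.

Definition tree_hd (t : tree) : tree := if t is Node l _ then l else Leaf.
Definition tree_tl (t : tree) : tree := if t is Node _ r then r else Leaf.
Definition tree_of_bool (b : bool) : tree := if b then Node Leaf Leaf else Leaf.

Inductive while_expr : Type :=
| EVar of nat
| ELeaf
| ENode of while_expr & while_expr
| EHd of while_expr
| ETl of while_expr
| EEq of while_expr & while_expr.

Inductive while_cmd : Type :=
| CSkip
| CAssign of nat & while_expr
| CSeq of while_cmd & while_cmd
| CWhile of while_expr & while_cmd.

Definition store : Type := nat -> tree.

Fixpoint while_eval (s : store) (e : while_expr) : tree :=
  match e with
  | EVar x => s x
  | ELeaf => Leaf
  | ENode e1 e2 => Node (while_eval s e1) (while_eval s e2)
  | EHd e1 => tree_hd (while_eval s e1)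
  | ETl e1 => tree_tl (while_eval s e1)
  | EEq e1 e2 => tree_of_bool (tree_eqb (while_eval s e1) (while_eval s e2))
  end.

Definition store_set (s : store) (x : nat) (t : tree) : store :=
  fun y => if y == x then t else s y.

Inductive while_exec : while_cmd -> store -> store -> Prop :=
| exec_skip s : while_exec CSkip s s
| exec_assign s x e : while_exec (CAssign x e) s (store_set s x (while_eval s e))
| exec_seq s s' s'' c c' :
    while_exec c s s' -> while_exec c' s' s'' -> while_exec (CSeq c c') s s''
| exec_while_false s e c :
    while_eval s e = Leaf -> while_exec (CWhile e c) s s
| exec_while_true s s' s'' e c :
    while_eval s e <> Leaf -> while_exec c s s' ->
    while_exec (CWhile e c) s' s'' -> while_exec (CWhile e c) s s''.

Definition input_store (t : tree) : store := fun x => if x == 0%N then t else Leaf.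

Definition algorithmically_decidable (I : Type) (code : I -> tree)
    (P : I -> Prop) : Prop :=
  exists c : while_cmd, forall i : I, exists2 s : store,
    while_exec c (input_store (code i)) s & s 0%N = tree_of_bool `[< P i >].

Definition code_seq (T : Type) (code : T -> tree) (s : seq T) : tree :=
  foldr (fun x t => Node (code x) t) Leaf s.

Definition code_nat (n : nat) : tree := iter n (Node Leaf) Leaf.

Definition code_letter (B : finType) (b : B) : tree := code_nat (enum_rank b).

Definition code_transition (B : finType) (t : nat * B * nat) : tree :=
  Node (code_nat t.1.1) (Node (code_letter t.1.2) (code_nat t.2)).

Definition code_nfa (B : finType) (N : nfa B) : tree :=
  Node (code_seq code_nat (nfa_init N))
    (Node (code_seq code_nat (nfa_final N))
       (code_seq (@code_transition B) (nfa_trans N))).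

Definition code_instance (B : finType) (i : nfa B * word B) : tree :=
  Node (code_nfa i.1) (code_seq (@code_letter B) i.2).

Definition decidable_rational_subset_membership (M : monoidType) : Prop :=
  exists (B : finType) (sigma : word B -> M),
    surjective_morphism sigma /\
    algorithmically_decidable (@code_instance B)
      (fun i => (sigma @` nfa_language i.1) (sigma i.2)).

(* Main.v *)
Require Import Defs.
From HB Require Import structures.
From Stdlib Require Import Relation_Operators Operators_Properties.
From mathcomp Require Import all_boot all_order all_algebra.
From mathcomp Require Import finmap.
From mathcomp Require Import all_classical all_reals.
From mathcomp Require Import topology normedtype sequences.
From mathcomp Require Import zify ring.

Set Implicit Arguments.
Unset Strict Implicit.
Unset Printing Implicit Defensive.

Local Open Scope classical_set_scope.
Local Open Scope nat_scope.

(* Generically all relation words are long compared with a bound [l] such that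
   no word of length [l] occurs at two places in the relation words, so that
   distinct relation words can only overlap in fewer than [l] letters.  In a
   word [w], call an occurrence of a relation word without its last [l] letters
   live if the text that follows it can be rewritten so as to complete the
   relation word; a live occurrence can then be exchanged for the other side of
   its relation.  Reading [w] from left to right and replacing each live
   occurrence by a fixed side of its relation computes a normal form for the
   congruence: applying a relation changes the sides present at the live
   occurrences, but neither their order nor the text between them.  Liveness
   depends on what follows in a finite-state way, so the normal form is computed
   by a transducer, and the monoid is rational.  All the other properties follow
   from this: the words representing the elements of a rational subset form a
   regular language, the multiplication table is read off by a linear grammar, and
   membership is reachability in the product of two automata.

   For the genericity, let [2 ^ m <= n < 2 ^ m.+1] and [l = 3 * m.+1].  A
   presentation in which a factor of length [l] is repeated yields [#|A| ^ l]
   presentations of the same length by overwriting the second copy, and one with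
   a word shorter than [4 * l] yields [n / 2k] of them by lengthening this word.
   Both maps are injective up to fewer choices, by a factor of order [m], than
   there are images, so the exceptional presentations have density [O(1 / m)]. *)

(** * Small overlap words *)

(** The obstacle is that complete occurrences of relation words are not invariant under the
    congruence: two consecutive ones may share letters, and exchanging the right one for its other
    side destroys the end of the left one. Such an overlap has fewer than [l] letters, so cutting
    off the last [l] letters leaves a part that no exchange on the right can touch; whether the rest
    can be restored is recorded as liveness. No such cut is made on the left: what an exchange on
    the left removes from the beginning of the next relation word is an end of a side of the
    relation just read, and a reader moving to the right can remember that relation. Liveness
    depends on arbitrarily long text to the right. Hence the transducer is nondeterministic, and the
    properties are derived from runs with silent moves instead of from a deterministic machine. For
    decidability the search through the product automaton is moreover written as an actual WHILE
    program, which is why it works on lists with a fixed number of rounds. *)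

Lemma overlap_factor (T : eqType) (f g w : seq T) p q t n :
  prefix f (drop p w) -> prefix g (drop q w) -> p <= t -> q <= t ->
  t + n <= p + size f -> t + n <= q + size g ->
  take n (drop (t - p) f) = take n (drop (t - q) g).
Proof.
have aux f' p' : prefix f' (drop p' w) -> p' <= t -> t + n <= p' + size f' ->
    take n (drop (t - p') f') = take n (drop t w).
  move=> /prefixP[y e] pt tn.
  have [->|n0] := posnP n; first by rewrite !take0.
  have -> : drop t w = drop (t - p') f' ++ y.
    rewrite -(subnK pt) -drop_drop e drop_cat addnK; case: ltnP => // h; lia.
  by rewrite takel_cat // size_drop; lia.
by move=> hf hg pt qt tf tg; rewrite !aux.
Qed.

Section SmallOverlap.
Variables (A J : finType) (r : J * bool -> seq A) (l : nat).
Local Notation I := (J * bool)%type.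
Implicit Types (i : I) (y z w h : seq A) (n c : nat).

(* [r (j, false)] and [r (j, true)] are the two sides of the relation [j]. *)
Definition bar i : I := (i.1, ~~ i.2).

Hypothesis l_gt0 : 0 < l.
Hypothesis r_long : forall i, 4 * l <= size (r i).
Hypothesis r_uniq : forall i i' p p', p + l <= size (r i) ->
  p' + l <= size (r i') ->
  take l (drop p (r i)) = take l (drop p' (r i')) -> i = i' /\ p = p'.

Definition minus i : seq A := take (size (r i) - l) (r i).
Definition suf i : seq A := drop (size (r i) - l) (r i).

Lemma barK : involutive bar.
Proof. by case=> j b; rewrite /bar /= negbK. Qed.

Lemma minus_suf i : minus i ++ suf i = r i.
Proof. exact: cat_take_drop. Qed.

Lemma size_minus i : size (minus i) = size (r i) - l.
Proof. by rewrite size_takel // leq_subr. Qed.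

Lemma size_suf i : size (suf i) = l.
Proof. by rewrite size_drop; have := r_long i; lia. Qed.

Lemma drop_minus_cat i c : c <= l -> drop c (minus i) ++ suf i = drop c (r i).
Proof.
move=> cl; rewrite -[in RHS](minus_suf i) drop_cat size_minus.
by rewrite ifT //; have := r_long i; lia.
Qed.

Lemma take_minus i c : c <= l -> take c (minus i) = take c (r i).
Proof.
by move=> cl; rewrite take_takel //; have := r_long i; lia.
Qed.

(** The form in which [r_uniq] is applied: a window of [l] letters covered by two factors of
    relation words identifies both the word and the position in it. *)
Lemma overlap_uniq i i' u f v u' g v' w p q t :
  r i = u ++ f ++ v -> r i' = u' ++ g ++ v' ->
  prefix f (drop p w) -> prefix g (drop q w) -> p <= t -> q <= t ->
  t + l <= p + size f -> t + l <= q + size g ->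
  i = i' /\ size u + (t - p) = size u' + (t - q).
Proof.
move=> ei ei' hf hg pt qt tf tg.
have aux i0 (u0 f0 v0 : seq A) n : r i0 = u0 ++ f0 ++ v0 -> n + l <= size f0 ->
    size u0 + n + l <= size (r i0) /\
    take l (drop (size u0 + n) (r i0)) = take l (drop n f0).
  move=> -> le; rewrite !size_cat; split; first by lia.
  rewrite addnC -drop_drop drop_size_cat // drop_cat ifT; last by lia.
  by rewrite takel_cat // size_drop; lia.
have [le1 e1] := aux _ _ _ _ (t - p) ei ltac:(lia).
have [le2 e2] := aux _ _ _ _ (t - q) ei' ltac:(lia).
by apply: r_uniq => //; rewrite e1 e2 (overlap_factor hf hg).
Qed.

Lemma r_minus i c : c <= l -> r i = take c (r i) ++ drop c (minus i) ++ suf i.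
Proof. by move=> cl; rewrite drop_minus_cat // cat_take_drop. Qed.

(* [live i y]: the word [y] can be rewritten so as to begin with [suf i]. *)
Inductive live i : seq A -> Prop :=
| live_suf y : live i (suf i ++ y)
| live_next h i' y : size h < l -> prefix (suf i) (h ++ r (bar i')) ->
    live i' y -> live i (h ++ minus i' ++ y).

(* A relation word starting inside [minus i1] would have to end in the middle of
   the text that completes [minus i1] to [r i1], which contains no long factor of
   another relation word. *)
Lemma compare h1 c i1 z h i y :
  h1 ++ drop c (minus i1) ++ z = h ++ r i ++ y -> size h1 <= l -> c <= l ->
  (c == 0) || (h1 == [::]) -> live i1 z ->
  [/\ i1 = i, c = 0, h1 = h & z = suf i ++ y] \/
  exists2 h2, h = h1 ++ drop c (minus i1) ++ h2 & z = h2 ++ r i ++ y.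
Proof.
move=> e h1l cl c0 liv.
have ri := r_long i; have ri1 := r_long i1.
set m := size (drop c (minus i1)).
have em : m = size (r i1) - l - c by rewrite /m size_drop size_minus.
have stc : size (take c (r i1)) = c by rewrite size_takel //; lia.
pose w := h ++ r i ++ y.
have occ1 : prefix (drop c (minus i1)) (drop (size h1) w).
  by rewrite /w -e drop_size_cat // prefix_prefix.
have occ : prefix (r i) (drop (size h) w) by rewrite drop_size_cat // prefix_prefix.
have r0 : r i = [::] ++ r i ++ [::] by rewrite cats0.
(* A common window of [l] letters forces the same relation word in the same place. If [h1] is empty,
   [c > 0] would make the complete word [r i] start before the text, so [c] vanishes. *)
have [b1|b1] := leqP (size h + l) (size h1 + m).
  left; have := overlap_uniq (t := maxn (size h) (size h1)) (r_minus i1 cl) r0 occ1 occ.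
  case; rewrite -?/m; try lia.
  rewrite stc add0n => ei ec; have c00 : c = 0.
    by case/orP: c0 => /eqP // c0; move: ec; rewrite c0 /=; lia.
  have sh : size h1 = size h by move: ec; rewrite c00; lia.
  move: e; rewrite c00 ei drop0 => /eqP.
  rewrite eqseq_cat // => /andP[/eqP -> /eqP e].
  by move: e; rewrite -(minus_suf i) -catA => /eqP; rewrite eqseq_cat // => /andP[_ /eqP].
have [b2|b2] := leqP (size h1 + m) (size h).
  right; exists (drop (size h1 + m) h).
    have := congr1 (take (size h)) e; rewrite [in RHS]take_size_cat // => {1}<-.
    rewrite catA take_cat size_cat -/m ltnNge b2 /= -catA; do 2 congr (_ ++ _).
    have := congr1 (drop (size h1 + m)) e; rewrite catA drop_size_cat ?size_cat //.
    move=> ->; rewrite drop_cat; case: ltnP => hm; last first.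
      have -> : size h - (size h1 + m) = 0 by lia.
      by rewrite take0 drop_oversize.
    by rewrite take_size_cat // size_drop.
  have := congr1 (drop (size h1 + m)) e; rewrite catA drop_size_cat ?size_cat // => ->.
  rewrite drop_cat; case: ltnP => // hm.
  have hs : size h = size h1 + m by lia.
  by rewrite hs subnn drop0 drop_oversize // hs.
exfalso.
pose d := size h1 + m - size h.
have ez : z = drop d (r i) ++ y.
  have := congr1 (drop (size h1 + m)) e; rewrite catA drop_size_cat ?size_cat // => ->.
  rewrite drop_cat ifF; last by lia.
  by rewrite drop_cat ifT //; lia.
have rd : r i = take d (r i) ++ drop d (r i) ++ [::] by rewrite cats0 cat_take_drop.
have occd : prefix (drop d (r i)) (drop 0 z) by rewrite ez drop0 prefix_prefix.
have sd : size (take d (r i)) = d by rewrite size_takel //; lia.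
have sdd : size (drop d (r i)) = size (r i) - d by rewrite size_drop.
case: liv ez occd => [y1|h2 i2 y2 h2l _ _] ez occd.
  have o1 : prefix (suf i1) (drop 0 (suf i1 ++ y1)) by rewrite drop0 prefix_prefix.
  have r1 : r i1 = minus i1 ++ suf i1 ++ [::] by rewrite cats0 minus_suf.
  have [] := overlap_uniq (t := 0) r1 rd o1 occd; rewrite ?size_suf ?sdd //; try lia.
  by move=> _; rewrite size_minus sd; lia.
have o1 : prefix (minus i2) (drop (size h2) (h2 ++ minus i2 ++ y2)).
  by rewrite drop_size_cat // prefix_prefix.
have r2 : r i2 = [::] ++ minus i2 ++ suf i2 by rewrite minus_suf.
have ri2 := r_long i2.
have [] := overlap_uniq (t := size h2) r2 rd o1 occd; rewrite ?size_minus ?sdd //; try lia.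
by move=> _; rewrite sd /=; lia.
Qed.

Lemma prefix_cat_size1 (h y u : seq A) :
  size u <= size h -> prefix u (h ++ y) -> prefix u h.
Proof. by move=> le; rewrite !prefixE takel_cat. Qed.

Lemma prefix_cat_size (h x y u : seq A) :
  size u <= size h + size x -> prefix u (h ++ x ++ y) -> prefix u (h ++ x).
Proof. by rewrite catA => le; apply: prefix_cat_size1; rewrite size_cat. Qed.

Lemma prefix_live i y : prefix (suf i) y -> live i y.
Proof. by move=> /prefixP[z ->]; exact: live_suf. Qed.

(** If [suf i1] was read off directly and reaches into [r i], it is lost in the new text, but
    exchanging [r (bar i)] back restores it, and this is an instance of [live_next]. So liveness is
    invariant although direct occurrences are not. *)
Lemma live_bar i1 h i y :
  live i1 (h ++ r i ++ y) -> live i1 (h ++ r (bar i) ++ y).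
Proof.
have [n] := ubnP (size h); elim: n => // n IHn in i1 h *; rewrite ltnS => hn.
move e : (h ++ r i ++ y) => w liv.
case: liv e => [y1|h1 i' y1 h1l pre liv] e.
  have p1 : prefix (suf i1) (h ++ r i ++ y) by rewrite e prefix_prefix.
  have [lh|lh] := leqP l (size h).
    apply: prefix_live; apply: prefix_catl.
    by apply: prefix_cat_size1 p1; rewrite size_suf.
  rewrite -(minus_suf (bar i)) -catA; apply: live_next => //; last exact: live_suf.
  rewrite barK; apply: prefix_cat_size p1.
  by rewrite size_suf; have := r_long i; lia.
have e' : h1 ++ drop 0 (minus i') ++ y1 = h ++ r i ++ y by rewrite drop0.
have [[ei' _ eh ey]|[h2 eh ey]] := compare e' (ltnW h1l) (leq0n l) isT liv.
  by apply: prefix_live; rewrite -eh -ei' catA prefix_catl.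
rewrite drop0 in eh; rewrite eh -!catA; apply: live_next => //.
rewrite ey in liv; apply: IHn liv.
move: hn; rewrite eh !size_cat size_minus; have := r_long i'; lia.
Qed.

(** * The reading algorithm for the normal form *)

Definition canon_index i n : I :=
  if take n (r i) == take n (r (bar i)) then (i.1, false) else i.

(* The output is the side of the relation that begins with the [n] letters already
   written, with preference for [false]; it only depends on these letters. *)
Definition emit i n : seq A := drop n (r (canon_index i n)).

Definition overlaps (m : option J) i n : bool :=
  (n == 0) ||
  (if m is Some j then [exists b, suffix (take n (r i)) (r (j, b))] else false).

Definition matches (m : option J) z (x : I * 'I_l.+1) : bool :=
  [&& overlaps m x.1 x.2, prefix (drop x.2 (minus x.1)) z
    & `[< live x.1 (drop (size (minus x.1) - x.2) z) >]].

(** The constructor [live_next] as a test on the current text: the second component of [x] is the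
    length of [h]. *)
Definition completes i z (x : I * 'I_l) : bool :=
  [&& prefix (minus x.1) (drop x.2 z), prefix (suf i) (take x.2 z ++ r (bar x.1))
    & `[< live x.1 (drop (x.2 + size (minus x.1)) z) >]].

(* What has been read: plain text ([inl None]), a word equivalent to a side of
   the relation [j] ([inl (Some j)]), so that the next relation word may lack a
   beginning that is an end of one of these sides, or [minus i] ([inr i]), in which
   case [suf i] is still to be cancelled from an equivalent of the remaining word. *)
Definition mode := (option J + I)%type.

(** The number counts the letters to skip after the current one, hence the predecessors. In mode
    [inr i] the output already accounts for [suf i]. When [completes] applies, the last [l - x.2]
    letters of [suf i] are the first letters of [r (bar x.1)], so only the remainder of that side is
    emitted. The last branch of this mode is a default: the mode is entered only when the remaining
    text is live. *)
Definition step (m : mode) z : seq A * nat * mode :=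
  match m with
  | inl o =>
    if [pick x | matches o z x] is Some x then
      (emit x.1 x.2, (size (minus x.1) - x.2).-1, inr x.1)
    else (take 1 z, 0, inl None)
  | inr i =>
    if prefix (suf i) z then ([::], l.-1, inl (Some i.1))
    else if [pick x | completes i z x] is Some x then
      (emit (bar x.1) (l - x.2), (x.2 + size (minus x.1)).-1, inr x.1)
    else (take 1 z, 0, inl None)
  end.

Fixpoint normal n (m : mode) z : seq A :=
  if z is _ :: z' then
    if n is n'.+1 then normal n' m z'
    else let s := step m z in s.1.1 ++ normal s.1.2 s.2 z'
  else [::].

Lemma normal_drop n m z : normal n m z = normal 0 m (drop n z).
Proof. by elim: z n => [|a z IH] [|n] //=. Qed.

Lemma normal_step m z : 0 < size z ->
  normal 0 m z = (step m z).1.1 ++ normal 0 (step m z).2 (drop (step m z).1.2.+1 z).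
Proof. by case: z => [//|a z] _; rewrite [LHS]/= normal_drop. Qed.

(** The effect of the factor 4 in [r_long]: even after an overlap has taken [l] letters from its
    beginning, [minus i] keeps [2 * l] of them, and two occurrences of that length starting fewer
    than [l] letters apart share a window of [l] letters. *)
Lemma size_minus_gt i : 3 * l <= size (minus i).
Proof. by rewrite size_minus; have := r_long i; lia. Qed.

(** Makes [pick] in [step] return whatever match a proof exhibits, so that [normal] can be unfolded
    along it. *)
Lemma matches_uniq o z x x' : matches o z x -> matches o z x' -> x = x'.
Proof.
case: x x' => [i n] [i' n'] /and3P[_ /= p _] /and3P[_ /= p' _].
have gi := size_minus_gt i; have gi' := size_minus_gt i'.
have ln := ltn_ord n; have ln' := ltn_ord n'.
rewrite -[z]drop0 in p p'.
have nl : n <= l by []; have nl' : n' <= l by [].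
have [] := overlap_uniq (t := 0) (r_minus i nl) (r_minus i' nl') p p';
  rewrite ?size_drop; try lia.
move=> ei; rewrite !size_takel ?addn0; [|have := r_long i'; lia|have := r_long i; lia].
by move=> en; congr (_, _) => //; apply: val_inj.
Qed.

Lemma completes_uniq i0 z x x' : completes i0 z x -> completes i0 z x' -> x = x'.
Proof.
case: x x' => [i n] [i' n'] /and3P[/= p _ _] /and3P[/= p' _ _].
have gi := size_minus_gt i; have gi' := size_minus_gt i'.
have ln := ltn_ord n; have ln' := ltn_ord n'.
have r0 i1 : r i1 = [::] ++ minus i1 ++ suf i1 by rewrite minus_suf.
have [] := overlap_uniq (t := maxn n n') (r0 i) (r0 i') p p'; try lia.
by move=> -> /= en; congr (_, _) => //; apply: val_inj => /=; lia.
Qed.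

Lemma normal_match o z x : matches o z x ->
  normal 0 (inl o) z =
  emit x.1 x.2 ++ normal 0 (inr x.1) (drop (size (minus x.1) - x.2) z).
Proof.
move=> mx; have /and3P[_ p _] := mx.
have g := size_minus_gt x.1; have lx := ltn_ord x.2.
have sz : 0 < size z.
  by apply: leq_trans (size_prefix p); rewrite size_drop /=; lia.
rewrite normal_step //= /step; case: pickP => [x' mx'|/(_ x)]; last by rewrite mx.
by rewrite (matches_uniq mx' mx) /= prednK //; lia.
Qed.

Lemma normal_letter o a z : (forall x, ~~ matches o (a :: z) x) ->
  normal 0 (inl o) (a :: z) = a :: normal 0 (inl None) z.
Proof.
move=> nm; rewrite normal_step //= /step; case: pickP => [x|_ /=]; last by rewrite take0 drop0.
by rewrite (negbTE (nm x)).
Qed.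

Lemma normal_suf i z : normal 0 (inr i) (suf i ++ z) = normal 0 (inl (Some i.1)) z.
Proof.
rewrite normal_step /step /= ?prefix_prefix /=; last by rewrite size_cat size_suf; lia.
by rewrite prednK // drop_size_cat // size_suf.
Qed.

Lemma normal_completes i z x : ~~ prefix (suf i) z -> completes i z x ->
  normal 0 (inr i) z =
  emit (bar x.1) (l - x.2) ++ normal 0 (inr x.1) (drop (x.2 + size (minus x.1)) z).
Proof.
move=> np cx; have /and3P[p _ _] := cx.
have g := size_minus_gt x.1.
have sz : 0 < size z.
  by have := size_prefix p; rewrite size_drop /=; lia.
rewrite normal_step //= /step (negbTE np); case: pickP => [x' cx'|/(_ x)]; last by rewrite cx.
by rewrite (completes_uniq cx' cx) /= prednK //; lia.
Qed.

Lemma matchesP o z i n : n <= l -> overlaps o i n -> live i z ->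
  matches o (drop n (minus i) ++ z) (i, inord n).
Proof.
move=> nl ov lv; rewrite /matches /= inordK // ov prefix_prefix /=.
by apply/asboolP; rewrite drop_size_cat // size_drop.
Qed.

Lemma matchesE o z x : matches o z x ->
  exists2 z', z = drop x.2 (minus x.1) ++ z' & live x.1 z'.
Proof.
move=> /and3P[_ /prefixP[z' ->] /asboolP].
by rewrite drop_size_cat ?size_drop // => lv; exists z'.
Qed.

Lemma completesP i h i' z : size h < l -> prefix (suf i) (h ++ r (bar i')) ->
  live i' z -> exists2 x, completes i (h ++ minus i' ++ z) x & x.1 = i' /\ x.2 = size h :> nat.
Proof.
move=> hl p lv; exists (i', Ordinal hl) => //.
rewrite /completes /= drop_size_cat // prefix_prefix take_size_cat // p.
by apply/asboolP; rewrite addnC -drop_drop !drop_size_cat.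
Qed.

(** * Invariance of the normal form under exchanging the sides of a relation *)

Lemma live_bar_iff i1 h i y :
  live i1 (h ++ r i ++ y) <-> live i1 (h ++ r (bar i) ++ y).
Proof. by split=> [|/live_bar]; [exact: live_bar|rewrite barK]. Qed.

Lemma emit_bar i n : take n (r i) = take n (r (bar i)) -> emit i n = emit (bar i) n.
Proof. by move=> e; rewrite /emit /canon_index barK e eqxx. Qed.

Lemma normal_r o i c y : c <= l -> overlaps o i c ->
  normal 0 (inl o) (drop c (r i) ++ y) = emit i c ++ normal 0 (inl (Some i.1)) y.
Proof.
move=> cl ov; rewrite -drop_minus_cat // -catA.
rewrite (normal_match (matchesP cl ov (live_suf i y))) /= inordK //.
by rewrite drop_size_cat ?size_drop // normal_suf.
Qed.

Lemma overlaps0 o i : overlaps o i 0.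
Proof. by []. Qed.

(** As [h] is not empty, a match at its beginning is not [r i] itself; by [compare] it lies inside
    [h], and only its liveness looks further. *)
Lemma matches_bar o h i y x : h != [::] -> matches o (h ++ r i ++ y) x ->
  exists2 h2, h = drop x.2 (minus x.1) ++ h2 &
    live x.1 (h2 ++ r i ++ y) /\ matches o (h ++ r (bar i) ++ y) x.
Proof.
move=> h0 mx; have [z' e lv] := matchesE mx.
have nl : x.2 <= l by have := ltn_ord x.2.
have e' : [::] ++ drop x.2 (minus x.1) ++ z' = h ++ r i ++ y by [].
have [[_ _ eh _]|[h2 eh ez]] := compare e' (leq0n l) nl (orbT _) lv.
  by rewrite -eh in h0.
exists h2 => //; split; first by rewrite -ez.
have /and3P[ov _ _] := mx.
rewrite {1}eh -!catA; have := matchesP nl ov (z := h2 ++ r (bar i) ++ y).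
rewrite inord_val -surjective_pairing; apply.
by apply/live_bar_iff; rewrite barK -ez.
Qed.

Lemma prefix_suf_cat q h i y : size h < l ->
  prefix (suf q) (h ++ r i ++ y) -> suf q = h ++ take (l - size h) (r i).
Proof.
move=> hl; have ri := r_long i.
rewrite prefixE size_suf take_cat ltnNge ltnW //= takel_cat; last by lia.
by move/eqP.
Qed.

(** Cancelling [suf q] removes the first [l - size h] letters of [r i]; they form an end of the side
    [q], so the remainder is still recognised through [overlaps]. *)
Lemma normal_pending q h i y : prefix (suf q) (h ++ r i ++ y) -> size h < l ->
  normal 0 (inr q) (h ++ r i ++ y) =
  emit i (l - size h) ++ normal 0 (inl (Some i.1)) y.
Proof.
move=> p hl; have ri := r_long i.
have es := prefix_suf_cat hl p.
have -> : h ++ r i ++ y = suf q ++ drop (l - size h) (r i) ++ y.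
  by rewrite es -catA; congr (_ ++ _); rewrite catA cat_take_drop.
rewrite normal_suf normal_r ?leq_subr // /overlaps; apply/orP; right.
apply/existsP; exists q.2; rewrite -surjective_pairing -(minus_suf q) es catA.
exact: suffix_suffix.
Qed.

(** Occurrences met before [r i] lie inside [h] and stay live by [live_bar], so the two readings run
    in parallel up to [r i]. There [canon_index] hides which side is present whenever both sides fit
    the letters already written. *)
Lemma normal_bar m h i y :
  (if m is inr q then live q (h ++ r i ++ y) else True) ->
  normal 0 m (h ++ r i ++ y) = normal 0 m (h ++ r (bar i) ++ y).
Proof.
have [n] := ubnP (size h); elim: n => // n IHn in m h *; rewrite ltnS => hn.
case: m => [o _|q lv].
  have [->|h0] := eqVneq h [::].
    have := normal_r y (leq0n l) (overlaps0 o i); rewrite drop0 /= => ->.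
    have := normal_r y (leq0n l) (overlaps0 o (bar i)); rewrite drop0 /= => ->.
    by rewrite emit_bar // !take0.
  have [[x mx]|nm] := pselect (exists x, matches o (h ++ r i ++ y) x).
    have [h2 eh [lv mx']] := matches_bar h0 mx.
    rewrite (normal_match mx) (normal_match mx'); congr (_ ++ _).
    rewrite eh -!catA !drop_size_cat ?size_drop //; apply: IHn => //.
    move: hn; rewrite eh size_cat size_drop.
    by have := size_minus_gt x.1; have := ltn_ord x.2; lia.
  case: h h0 => // a h _ in hn nm *; rewrite !normal_letter.
  - by congr (_ :: _); apply: IHn.
  - move=> x; apply/negP => mx; apply: nm; exists x.
    by have [_ _ [_]] := @matches_bar o (a :: h) (bar i) y x isT mx; rewrite barK.
  - by move=> x; apply/negP => mx; apply: nm; exists x.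
(* Here the pending suffix ends inside [r i']. If the other side continues it as well, both sides
   share their first [l - size h] letters and [emit_bar] applies. Otherwise the other side is read
   through [completes], whose output for [bar i'] is again that for [i']. *)
have edge i' : prefix (suf q) (h ++ r i' ++ y) -> size h < l ->
    normal 0 (inr q) (h ++ r i' ++ y) = normal 0 (inr q) (h ++ r (bar i') ++ y).
  move=> p hl; rewrite normal_pending //; have ri := r_long i'; have rb := r_long (bar i').
  have [p'|np'] := boolP (prefix (suf q) (h ++ r (bar i') ++ y)).
    rewrite (normal_pending p') // emit_bar //.
    have := prefix_suf_cat hl p; rewrite (prefix_suf_cat hl p').
    by move=> /(congr1 (drop (size h))); rewrite !drop_size_cat.
  have p1 : prefix (suf q) (h ++ r (bar (bar i'))).
    by rewrite barK; apply: prefix_cat_size p; rewrite size_suf; lia.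
  have [x cx [ex1 ex2]] := completesP hl p1 (live_suf (bar i') y).
  move: np' cx; rewrite -[in r _ ++ y](minus_suf (bar i')) -catA => np' cx.
  rewrite (normal_completes np' cx) ex1 ex2 barK addnC -drop_drop !drop_size_cat //.
  by rewrite normal_suf.
have [ph|nph] := boolP (prefix (suf q) h).
  have [h2 eh] := prefixP ph.
  rewrite eh -!catA !normal_suf; apply: IHn => //.
  by move: hn; rewrite eh size_cat size_suf; lia.
have [p|np] := boolP (prefix (suf q) (h ++ r i ++ y)).
  have hl : size h < l.
    by rewrite ltnNge; apply: contra nph => lh; apply: prefix_cat_size1 p; rewrite size_suf.
  exact: edge.
have [p|np'] := boolP (prefix (suf q) (h ++ r (bar i) ++ y)).
  have hl : size h < l.
    by rewrite ltnNge; apply: contra nph => lh; apply: prefix_cat_size1 p; rewrite size_suf.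
  by rewrite (edge _ p hl) barK.
move e : (h ++ r i ++ y) => w in lv np *.
case: lv e np => [y1|h1 i' y1 h1l pre liv] e np; first by rewrite prefix_prefix in np.
have e' : h1 ++ drop 0 (minus i') ++ y1 = h ++ r i ++ y by rewrite drop0.
have [[ei' _ eh ey]|[h2 eh ey]] := compare e' (ltnW h1l) (leq0n l) isT liv.
  by move: np'; rewrite -eh -ei' catA prefix_catl.
rewrite drop0 in eh.
have [x cx [ex1 ex2]] := completesP h1l pre liv.
rewrite (normal_completes np cx) ex1 ex2.
have liv' : live i' (h2 ++ r (bar i) ++ y) by apply: live_bar; rewrite -ey.
have [x' cx' [ex1' ex2']] := completesP h1l pre liv'.
have eb : h1 ++ minus i' ++ h2 ++ r (bar i) ++ y = h ++ r (bar i) ++ y.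
  by rewrite eh -!catA.
rewrite -eb in np' *.
rewrite (normal_completes np' cx') ex1' ex2' addnC -!drop_drop !drop_size_cat //.
congr (_ ++ _); rewrite ey; apply: IHn; last by rewrite -ey.
by move: hn; rewrite eh !size_cat; have := size_minus_gt i'; lia.
Qed.

(** * The normal form represents the same element *)

Section Soundness.
Variable E : seq A -> seq A -> Prop.
Hypothesis E_refl : forall u, E u u.
Hypothesis E_sym : forall u v, E u v -> E v u.
Hypothesis E_trans : forall u v w, E u v -> E v w -> E u w.
Hypothesis E_cat : forall u u' v v', E u u' -> E v v' -> E (u ++ v) (u' ++ v').
Hypothesis E_r : forall i, E (r i) (r (bar i)).

Lemma E_same i i' : i.1 = i'.1 -> E (r i) (r i').
Proof.
case: i i' => [j b] [_ b'] /= <-; have [->|] := eqVneq b b'; first exact: E_refl.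
by case: b b' => [] [] // _; exact: (E_r (j, _)).
Qed.

Lemma canon1 i n : (canon_index i n).1 = i.1.
Proof. by rewrite /canon_index; case: ifP. Qed.

Lemma take_canon i n : take n (r (canon_index i n)) = take n (r i).
Proof.
rewrite /canon_index; case: ifP => // /eqP e; case: i e => j [] //=.

Qed.

Lemma take_emit i n : take n (r i) ++ emit i n = r (canon_index i n).
Proof. by rewrite -take_canon cat_take_drop. Qed.

(** Each mode needs the text written before it. After a relation, equivalence is claimed only behind
    a side of it, because the next output may omit letters that this side supplies; in mode [inr i]
    the missing [suf i] stands on the output side already. *)
Lemma normal_sound m z :
  match m with
  | inl None => E (normal 0 m z) z
  | inl (Some j) => forall b, E (r (j, b) ++ normal 0 m z) (r (j, b) ++ z)
  | inr i => live i z -> E (r i ++ normal 0 m z) (minus i ++ z)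
  end.
Proof.
have [n] := ubnP (size z); elim: n => // n IHn in m z *; rewrite ltnS => hn.
have pending i c y : c <= l -> size y < n -> live i y ->
    E (take c (r i) ++ emit i c ++ normal 0 (inr i) y) (take c (r i) ++ drop c (minus i) ++ y).
  move=> cl hy lv; rewrite catA take_emit -(take_minus _ cl) catA cat_take_drop.
  apply: E_trans (IHn (inr i) y hy lv).
  by apply: E_cat => //; apply: E_same; rewrite canon1.
case: m => [o|i lv]; last first.
  have [p|np] := boolP (prefix (suf i) z).
    have [y e] := prefixP p; rewrite e normal_suf catA minus_suf.
    have := IHn (inl (Some i.1)) y _ i.2; rewrite -surjective_pairing; apply.
    by move: hn; rewrite e size_cat size_suf; lia.
  case: lv np hn => [y|h i' y hl pre lv] np hn; first by rewrite prefix_prefix in np.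
  have [x cx [ex1 ex2]] := completesP hl pre lv.
  rewrite (normal_completes np cx) ex1 ex2 addnC -drop_drop !drop_size_cat //.
  have es : suf i = h ++ take (l - size h) (r (bar i')).
    by apply: (@prefix_suf_cat _ _ _ [::]); rewrite ?cats0.
  rewrite -{1}(minus_suf i) es -!catA; do 2 apply: E_cat => //.
  rewrite catA take_emit; apply: E_trans (IHn (inr i') y _ lv); last first.
    by move: hn; rewrite !size_cat; have := size_minus_gt i'; lia.
  by apply: E_cat => //; apply: E_same; rewrite canon1.
have [[x mx]|nm] := pselect (exists x, matches o z x).
  have /and3P[ov _ _] := mx; have [y ez lv] := matchesE mx.
  have cl : x.2 <= l by have := ltn_ord x.2.
  rewrite (normal_match mx) ez drop_size_cat ?size_drop //.
  have hy : size y < n.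
    move: hn; rewrite ez size_cat size_drop.
    by have := size_minus_gt x.1; have := ltn_ord x.2; lia.
  have := pending _ _ _ cl hy lv; case: o ov {mx} => [j|].
    case/orP => [/eqP -> |/existsP[b /suffixP[u eu]]] P b'.
      by apply: E_cat => //; move: P; rewrite take0.
    (* Splitting a side of [j] into [u] and the overlap brings back the letters omitted by
       [emit]. *)
    have cl' d : E (r (j, b') ++ d) (u ++ take x.2 (r x.1) ++ d).
      by rewrite catA -eu; apply: E_cat => //; apply: E_same.
    apply: E_trans (cl' _) _; apply: E_trans (E_sym (cl' _)).
    exact: E_cat.
  by rewrite /overlaps orbF => /eqP ->; rewrite take0.
case: z hn nm => [|a z] hn nm; first by case: o {nm} => [j b|]; exact: E_refl.
rewrite normal_letter; last by move=> x; apply/negP => mx; apply: nm; exists x.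
have Ez : E (a :: normal 0 (inl None) z) (a :: z).
  by apply: (@E_cat [:: a] [:: a]) => //; exact: (IHn (inl None)).
by case: o {nm} => [j b|] //; apply: E_cat.
Qed.

End Soundness.
End SmallOverlap.

(** * Transductions, automata and rational subsets *)

Section Runs.
Variables (Q B C : Type) (d : Q -> option B -> option C -> Q -> Prop).

Inductive run : Q -> seq B -> seq C -> Q -> Prop :=
| run_nil q : run q [::] [::] q
| run_step q b c q' x y q'' : d q b c q' -> run q' x y q'' ->
    run q (seq_of_opt b ++ x) (seq_of_opt c ++ y) q''.

Lemma run_cat q x y q' x' y' q'' :
  run q x y q' -> run q' x' y' q'' -> run q (x ++ x') (y ++ y') q''.
Proof.
elim=> [//|{}q b c q1 {}x {}y {}q' dq _ IH r2]; rewrite -!catA.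
by apply: run_step dq _; exact: IH.
Qed.

Lemma run1 q b c q' : d q b c q' -> run q (seq_of_opt b) (seq_of_opt c) q'.
Proof.
by move=> dq; rewrite -[seq_of_opt b]cats0 -[seq_of_opt c]cats0;
  apply: run_step dq (run_nil _).
Qed.

Lemma run_cons_in q b x y q' : run q (b :: x) y q' ->
  exists q1 q2 y1 c y2, [/\ run q [::] y1 q1, d q1 (Some b) c q2, run q2 x y2 q'
    & y = y1 ++ seq_of_opt c ++ y2].
Proof.
move e : (b :: x) => w rn; elim: rn b x e => // {}q [b'|] c q1 {}w {}y {}q' dq rn IH b x /=.
  move=> [-> ->]; exists q, q1, [::], c, y; split=> //; exact: run_nil.
move=> /IH[p1 [p2 [y1 [c' [y2 [r1 d1 r2 ->]]]]]].
exists p1, p2, (seq_of_opt c ++ y1), c', y2; split=> //; last by rewrite !catA.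
by rewrite -[[::]]/(seq_of_opt None ++ [::]); apply: run_step dq r1.
Qed.

End Runs.

Lemma run_swap Q B C d q x y q' : @run Q B C d q x y q' ->
  run (fun p c b p' => d p b c p') q y x q'.
Proof. by elim=> [p|p b c p' x' y' p'' dp _ IH]; [exact: run_nil|exact: run_step IH]. Qed.

(** Finitely many states, and transitions given by an arbitrary predicate with an optional letter on
    each tape. The silent moves make inversion, composition and concatenation direct. *)
Definition transduction B C (R : seq B -> seq C -> Prop) : Prop :=
  exists (Q : finType) (d : Q -> option B -> option C -> Q -> Prop) (i f : Q -> Prop),
  forall x y, R x y <-> exists q q', [/\ i q, f q' & run d q x y q'].

Lemma transduction_ext B C (R S : seq B -> seq C -> Prop) :
  (forall x y, R x y <-> S x y) -> transduction R -> transduction S.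
Proof.
by move=> RS [Q [d [i [f H]]]]; exists Q, d, i, f => x y; rewrite -RS; exact: H.
Qed.

Lemma transduction_inv B C (R : seq B -> seq C -> Prop) :
  transduction R -> transduction (fun y x => R x y).
Proof.
move=> [Q [d [i [f H]]]]; exists Q, (fun p c b p' => d p b c p'), i, f => x y.
by rewrite H; split=> -[q [q' [iq fq rn]]]; exists q, q'; split=> //; exact: (run_swap rn).
Qed.

Section Composition.
Variables (B C D Q1 Q2 : Type).
Variables (d1 : Q1 -> option B -> option C -> Q1 -> Prop).
Variables (d2 : Q2 -> option C -> option D -> Q2 -> Prop).

Definition comp_step (p : Q1 * Q2) (b : option B) (e : option D) (p' : Q1 * Q2) :=
  [\/ [/\ d1 p.1 b None p'.1, p'.2 = p.2 & e = None],
      [/\ d2 p.2 None e p'.2, p'.1 = p.1 & b = None]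
    | exists c, d1 p.1 b (Some c) p'.1 /\ d2 p.2 (Some c) e p'.2].

Lemma run_comp_sound p x z p' : run comp_step p x z p' ->
  exists y, run d1 p.1 x y p'.1 /\ run d2 p.2 y z p'.2.
Proof.
elim=> [{}p|{}p b e q {}x {}z {}p' st _ [y [r1 r2]]]; first by exists [::]; split; exact: run_nil.
case: st => [[s1 e2 ->]|[s2 e1 ->]|[c [s1 s2]]].
- exists y; split; first exact: (run_step s1 r1).
  by rewrite -e2.
- exists y; split; first by rewrite -e1.
  exact: (run_step s2 r2).
- by exists (c :: y); split; [exact: (run_step s1 r1)|exact: (run_step s2 r2)].
Qed.

Lemma run_comp_complete p x y p' q z q' :
  run d1 p x y p' -> run d2 q y z q' -> run comp_step (p, q) x z (p', q').
Proof.
(* Moves of the second machine that read nothing are executed while the first one waits. *)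
have aux s w t : run d2 s [::] w t -> forall p0, run comp_step (p0, s) [::] w (p0, t).
  move e : [::] => u rn; elim: rn e => [s0 _ p0|s0 [//|] e' s1 u' w' t' ds _ IH eu p0].
    exact: run_nil.
  rewrite -[[::]]/(seq_of_opt None ++ [::]).
  by apply: (@run_step _ _ _ _ _ _ _ (p0, s1)); [apply: Or32|exact: IH].
move=> r1; elim: r1 q z => [{}p q z r2|{}p b [c|] p1 {}x {}y {}p' s1 _ IH q z].
- exact: aux.
- move=> /= rn; have [q1 [q2 [z1 [e [z2 [r2 s2 r3 ->]]]]]] := run_cons_in rn.
  rewrite -[_ ++ x]/([::] ++ (seq_of_opt b ++ x)).
  apply: run_cat (aux _ _ _ r2 _) _; apply: (@run_step _ _ _ _ _ _ _ (p1, q2)).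
    by apply: Or33; exists c.
  exact: IH.
- move=> r2; rewrite -[z]/(seq_of_opt None ++ z).
  by apply: (@run_step _ _ _ _ _ _ _ (p1, q)); [apply: Or31|exact: IH].
Qed.

End Composition.

Lemma transduction_comp B C D (R : seq B -> seq C -> Prop) (S : seq C -> seq D -> Prop) :
  transduction R -> transduction S ->
  transduction (fun x z => exists2 y, R x y & S y z).
Proof.
move=> [Q1 [d1 [i1 [f1 H1]]]] [Q2 [d2 [i2 [f2 H2]]]].
exists (Q1 * Q2)%type, (comp_step d1 d2), (fun p => i1 p.1 /\ i2 p.2),
  (fun p => f1 p.1 /\ f2 p.2) => x z; split.
  move=> [y /H1[p [p' [ip fp r1]]] /H2[q [q' [iq fq r2]]]].
  by exists (p, q), (p', q'); split=> //; exact: run_comp_complete r1 r2.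
move=> [[p q] [[p' q'] [[/= ip iq] [/= fp fq] /run_comp_sound[y [r1 r2]]]]].
by exists y; [apply/H1; exists p, p'|apply/H2; exists q, q'].
Qed.

Lemma run_split_in Q B C d q x1 x2 y q' : @run Q B C d q (x1 ++ x2) y q' ->
  exists p y1 y2, [/\ run d q x1 y1 p, run d p x2 y2 q' & y = y1 ++ y2].
Proof.
elim: x1 q y => [|b x1 IH] q y rn.
  by exists q, [::], y; split=> //; exact: run_nil.
have [q1 [q2 [z1 [e [z2 [r2 s2 /IH[p [y1 [y2 [r3 r4 ->]]]] ->]]]]]] := run_cons_in rn.
exists p, (z1 ++ seq_of_opt e ++ y1), y2; split; rewrite -?catA //.
rewrite -[b :: x1]/([::] ++ (seq_of_opt (Some b) ++ x1)).
by apply: run_cat r2 _; exact: run_step s2 r3.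
Qed.

Definition dfa B (L : seq B -> Prop) : Prop :=
  exists (Q : finType) (d : Q -> B -> Q) (i : Q) (f : Q -> Prop),
  forall w, L w <-> f (foldl d i w).

(** Subset construction in which one step is an entire run reading a single letter, so that silent
    moves are absorbed; the initial subset contains everything reachable on empty input. *)
Lemma dfa_dom B C (R : seq B -> seq C -> Prop) :
  transduction R -> dfa (fun x => exists y, R x y).
Proof.
move=> [Q [d [i [f H]]]].
pose D (S : {set Q}) b := [set q' | `[< exists q y, q \in S /\ run d q [:: b] y q' >]]%SET.
pose S0 := [set q | `[< exists q0 y, i q0 /\ run d q0 [::] y q >]]%SET.
exists {set Q}, D, S0, (fun S : {set Q} => exists2 q, f q & q \in S) => w.
have reach q : q \in foldl D S0 w <-> exists q0 y, i q0 /\ run d q0 w y q.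
  elim/last_ind: w q => [|w b IH] q; first by rewrite inE; split=> /asboolP.
  rewrite foldl_rcons inE; split=> [/asboolP[p [y [/IH[q0 [y0 [i0 r0]]] r]]]|].
    by exists q0, (y0 ++ y); split=> //; rewrite -cats1; exact: run_cat r0 r.
  move=> [q0 [y [i0]]]; rewrite -cats1 => rn.
    have [p [y1 [y2 [r1 r2 _]]]] := run_split_in rn.
  by apply/asboolP; exists p, y2; split=> //; apply/IH; exists q0, y1.
split=> [[y /H[q [q' [iq fq rn]]]]|[q fq /reach[q0 [y [i0 rn]]]]].
  by exists q' => //; apply/reach; exists q, y.
by exists y; apply/H; exists q0, q.
Qed.

Lemma dfa_transduction B (L : seq B -> Prop) :
  dfa L -> transduction (fun x y => y = x /\ L x).
Proof.
move=> [Q [d [i [f H]]]].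
exists Q, (fun p b c q => exists a, [/\ b = Some a, c = Some a & q = d p a]),
  (fun q => q = i), f => x y; split=> [[-> /H fx]|[_ [q' [-> fq rn]]]].
  exists i, (foldl d i x); split=> //; elim: x i {fx H} => [|a x IH] q; first exact: run_nil.
  rewrite -[a :: x]/(seq_of_opt (Some a) ++ x); apply: run_step (IH _); by exists a.
suff [-> e] : y = x /\ q' = foldl d i x by split=> //; apply/H; rewrite -e.
by elim: rn {H fq} => // q b c q1 {}x {}y q2 [a [-> -> ->]] _ [-> ->].
Qed.

Lemma dfa_regular (B : finType) (L : seq B -> Prop) : dfa L -> regular (L : set (word B)).
Proof.
move=> [Q [d [i [f H]]]].
pose code (q : Q) : nat := enum_rank q.
pose T := [seq (code p.1, p.2, code (d p.1 p.2)) | p <- enum {: Q * B}].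
exists (Nfa [:: code i] [seq code q | q <- enum Q & `[< f q >]] T).
have code_inj : injective code by move=> p q /val_inj/enum_rank_inj.
have acc q w : nfa_accepts_from (Nfa [:: code i] [seq code q | q <- enum Q & `[< f q >]] T)
    (code q) w <-> f (foldl d q w).
  elim: w q => [|a w IH] q /=.
    rewrite mem_map // mem_filter mem_enum andbT; split=> [/asboolP //|fq]; exact/asboolP.
  split=> [/hasP[t /mapP[[p b] _ ->]] /andP[/= /eqP[/code_inj -> ->]] /IH //|fq].
  apply/hasP; exists (code q, a, code (d q a)).
    by apply/mapP; exists (q, a); rewrite ?mem_enum.
  by rewrite /= eqxx; apply/IH.
apply/seteqP; split=> w; rewrite /nfa_language /mkset /= orbF.
  by move=> /H/acc.
by move=> /acc/H.
Qed.

(** * Kleene's construction in an arbitrary monoid *)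

Section Kleene.
Variables (M : monoidType) (Q : finType) (lab : Q -> Q -> set M).
Hypothesis lab_rat : forall p q, rational_subset (lab p q).

Inductive path_product : Q -> M -> Q -> Prop :=
| path_product_nil q : path_product q 1%g q
| path_product_cons p x q y q' :
    lab p q x -> path_product q y q' -> path_product p (x * y)%g q'.

Definition setM (X Y : set M) : set M := [set (x * y)%g | x in X & y in Y].

(* The products along the paths all of whose intermediate states are in [s]. *)
Fixpoint through (s : seq Q) (p q : Q) : set M :=
  if s is r :: s' then
    through s' p q `|`
    setM (setM (through s' p r) (smallest (@submonoid M) (through s' r r))) (through s' r q)
  else lab p q `|` [set x | p = q /\ x = 1%g].

Lemma through_rat s p q : rational_subset (through s p q).
Proof.
elim: s p q => [|r s IH] p q /=.
  apply: rational_union => //; apply: rational_finite.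
  have [<-|npq] := pselect (p = q).
    by apply: (@sub_finite_set _ _ [set 1%g]) => // x [_ ->].
  by apply: (@sub_finite_set _ _ set0) => // x [].
by apply: rational_union => //; do 2 apply: rational_product => //; apply: rational_submonoid.
Qed.

Lemma star1 (X : set M) : smallest (@submonoid M) X 1%g.
Proof. by move=> Y [[Y1 _] _]. Qed.

Lemma starM (X : set M) x y : smallest (@submonoid M) X x ->
  smallest (@submonoid M) X y -> smallest (@submonoid M) X (x * y)%g.
Proof. by move=> hx hy Y YX; have [[_ YM] _] := YX; apply: YM; [exact: hx|exact: hy]. Qed.

Lemma star_sub (X : set M) x : X x -> smallest (@submonoid M) X x.
Proof. by move=> Xx Y [_ XY]; exact: XY. Qed.

Lemma through_mono s p q x : lab p q x \/ (p = q /\ x = 1%g) -> through s p q x.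
Proof. by move=> h; elim: s => [|r s IH] //=; left. Qed.

Lemma path_product_cat p x q y q' :
  path_product p x q -> path_product q y q' -> path_product p (x * y)%g q'.
Proof.
elim=> [{}p|{}p {}x p1 x' {}q l1 _ IH] r2; first by rewrite mul1g.
by rewrite -mulgA; apply: path_product_cons l1 (IH r2).
Qed.

Lemma through_sound s p q x : through s p q x -> path_product p x q.
Proof.
elim: s p q x => [|r s IH] p q x /=.
  case=> [l|[-> ->]]; last exact: path_product_nil.
  by rewrite -[x]mulg1; apply: path_product_cons l (path_product_nil _).
case=> [/IH //|[_ [x1 /IH h1 [x2 h2 <-]] [x3 /IH h3 <-]]].
apply: path_product_cat h3; apply: path_product_cat h1 _.
apply: (h2 [set y | path_product r y r]); split=> [|y /IH //]; split; first exact: path_product_nil.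
by move=> y z; exact: path_product_cat.
Qed.

(** With all states in [s], this closure under concatenation at an intermediate state lets an
    induction on paths add one edge at a time. *)
Lemma through_cat s p q q' x y : q \in s ->
  through s p q x -> through s q q' y -> through s p q' (x * y)%g.
Proof.
have mk r s0 p0 q0 a b c : through s0 p0 r a ->
    smallest (@submonoid M) (through s0 r r) b -> through s0 r q0 c ->
    setM (setM (through s0 p0 r) (smallest (@submonoid M) (through s0 r r)))
      (through s0 r q0) (a * b * c)%g.
  by move=> ha hb hc; exists (a * b)%g; [exists a => //; exists b|exists c].
elim: s p q q' x y => // r s IH p q q' x y; rewrite inE => /predU1P[->|qs] /= hx hy.
  have {hx} [x1 h1 [x2 h2 ->]] : exists2 x1, through s p r x1 &
      exists2 x2, smallest (@submonoid M) (through s r r) x2 & x = (x1 * x2)%g.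
    case: hx => [hx|[_ [x1 h1 [x2 h2 <-]] [x3 h3 <-]]].
      by exists x => //; exists 1%g; [exact: star1|rewrite mulg1].
    exists x1 => //; exists (x2 * x3)%g; last by rewrite mulgA.
    by apply: starM => //; exact: star_sub.
  right; case: hy => [hy|[_ [y1 k1 [y2 k2 <-]] [y3 k3 <-]]]; first exact: mk.
  rewrite !mulgA -(mulgA x1) -(mulgA x1); apply: mk => //.
  by apply: starM => //; apply: starM => //; exact: star_sub.
case: hx => [hx|[_ [x1 h1 [x2 h2 <-]] [x3 h3 <-]]].
  case: hy => [hy|[_ [y1 k1 [y2 k2 <-]] [y3 k3 <-]]]; first by left; exact: (IH _ _ _ _ _ qs hx hy).
  by right; rewrite !mulgA; apply: mk => //; exact: (IH _ _ _ _ _ qs hx k1).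
right; case: hy => [hy|[_ [y1 k1 [y2 k2 <-]] [y3 k3 <-]]].
  by rewrite -mulgA; apply: mk => //; exact: (IH _ _ _ _ _ qs h3 hy).
rewrite !mulgA -3!(mulgA x1); apply: mk => //.
rewrite -(mulgA x2); apply: starM => //; apply: starM => //.
by apply: star_sub; exact: (IH _ _ _ _ _ qs h3 k1).
Qed.

Lemma path_product_rational p q : rational_subset [set x | path_product p x q].
Proof.
rewrite (_ : [set x | _] = through (enum Q) p q); first exact: through_rat.
apply/seteqP; split=> x; last exact: through_sound.
elim=> [{}q|{}p y r z q' l _ h]; first by apply: through_mono; right.
by apply: through_cat h; [rewrite mem_enum|apply: through_mono; left].
Qed.

End Kleene.

(** A pair of optional letters is an element of the product monoid, so a run of the transducer is a
    path product there. *)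
Lemma transduction_rational (B C : finType) (R : word B -> word C -> Prop) :
  transduction R -> rational_relation R.
Proof.
move=> [Q [d [i [f H]]]].
pose lab p q : set (word B * word C) := [set (seq_of_opt bc.1 : word B, seq_of_opt bc.2 : word C)
  | bc in [set bc | d p bc.1 bc.2 q]].
have lab_rat p q : rational_subset (lab p q).
  by apply: rational_finite; apply: finite_image; exact: finite_finset.
have path p x y q : path_product lab p (x, y) q <-> run d p x y q.
  split; last first.
    elim=> [{}p|{}p b c q1 {}x {}y {}q dp _ IH]; first exact: (path_product_nil lab p).
    rewrite -[(_, _)]/((seq_of_opt b : word B, seq_of_opt c : word C) * (x : word B, y : word C))%g.
    by apply: path_product_cons IH; exists (b, c).
  move e : (x, y) => xy pp; elim: pp x y e => [{}p _ _ [-> ->]|]; first exact: run_nil.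
  move=> {}p _ q1 [x' y'] {}q [[b c] /= dp <-] _ IH _ _ [-> ->].
  by apply: run_step dp _; exact: IH.
rewrite /rational_relation (_ : [set uv | _] =
  \bigcup_(pq in [set pq : Q * Q | i pq.1 /\ f pq.2]) [set x | path_product lab pq.1 x pq.2]).
  rewrite bigcup_fset_set; last exact: finite_finset.
  elim/big_rec: _ => [|pq X _]; first by apply: rational_finite.
  by apply: rational_union; exact: path_product_rational.
apply/seteqP; split=> [[x y] /= /H[q [q' [iq fq rn]]]|[x y] /= [[q q'] /= [iq fq] /path rn]].
  by exists (q, q') => //; apply/path.
by apply/H; exists q, q'.
Qed.

(** A language is treated as a transduction without output letters, so that [transduction_comp] also
    yields preimages of languages. *)
Definition recognizable_lang B (K : seq B -> Prop) : Prop :=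
  transduction (fun x (_ : seq void) => K x).

Lemma seq_void (y : seq void) : y = [::].
Proof. by case: y => // -[]. Qed.

Lemma lang_dfa B (K : seq B -> Prop) : recognizable_lang K -> dfa K.
Proof.
move=> /dfa_dom[Q [d [i [f H]]]]; exists Q, d, i, f => w.
by rewrite -H; split=> [Kw|[]//]; exists [::].
Qed.

Lemma run_map (Q Q' B C : Type) (g : Q -> Q') d d' :
  (forall p b c q, d p b c q -> d' (g p) b c (g q)) ->
  forall p x y q, @run Q B C d p x y q -> run d' (g p) x y (g q).
Proof.
move=> h p x y q; elim=> [p'|p' b c q1 x' y' q2 /h dp _ IH]; first exact: run_nil.
exact: run_step dp IH.
Qed.

Lemma run_silent (Q B C : Type) (d : Q -> option B -> option C -> Q -> Prop) p p' x y q :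
  d p None None p' -> run d p' x y q -> run d p x y q.
Proof. exact: run_step. Qed.

(** * Closure properties of regular languages *)

Section LanguageClosure.
Variable B : Type.
Implicit Types K L : seq B -> Prop.

Lemma lang_union K L : recognizable_lang K -> recognizable_lang L ->
  recognizable_lang (fun x => K x \/ L x).
Proof.
move=> [Q1 [d1 [i1 [f1 H1]]]] [Q2 [d2 [i2 [f2 H2]]]].
pose d (p : Q1 + Q2) b c q := match p, q with
  | inl p, inl q => d1 p b c q | inr p, inr q => d2 p b c q | _, _ => False end.
pose s (i1 : Q1 -> Prop) (i2 : Q2 -> Prop) q := match q with inl q => i1 q | inr q => i2 q end.
exists (Q1 + Q2)%type, d, (s i1 i2), (s f1 f2) => x y.
have dl p x' y' q' : run d (inl p) x' y' q' -> exists2 q, q' = inl q & run d1 p x' y' q.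
  move e : (inl p) => p' rn; elim: rn p e => [_ p <-|].
    by exists p => //; exact: run_nil.
  move=> q0 b c q1 x0 y0 q2 dp _ IH p e; subst q0; case: q1 dp IH => [q1|q1] //= dp IH.
  by have [q -> rn] := IH _ erefl; exists q => //; exact: run_step dp rn.
have dr p x' y' q' : run d (inr p) x' y' q' -> exists2 q, q' = inr q & run d2 p x' y' q.
  move e : (inr p) => p' rn; elim: rn p e => [_ p <-|].
    by exists p => //; exact: run_nil.
  move=> q0 b c q1 x0 y0 q2 dp _ IH p e; subst q0; case: q1 dp IH => [q1|q1] //= dp IH.
  by have [q -> rn] := IH _ erefl; exists q => //; exact: run_step dp rn.
split.
  case=> [/(H1 x y)|/(H2 x y)] [q [q' [iq fq rn]]].
    by exists (inl q), (inl q'); split=> //; exact: (run_map (g := inl) _ rn).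
  by exists (inr q), (inr q'); split=> //; exact: (run_map (g := inr) _ rn).
case=> -[q|q] [q' [/= iq fq rn]].
  by left; have [q1 e r1] := dl _ _ _ _ rn; apply/(H1 x y); exists q, q1; rewrite e in fq.
by right; have [q1 e r1] := dr _ _ _ _ rn; apply/(H2 x y); exists q, q1; rewrite e in fq.
Qed.

Lemma lang_cat K L : recognizable_lang K -> recognizable_lang L ->
  recognizable_lang (fun x => exists u v, [/\ K u, L v & x = u ++ v]).
Proof.
move=> [Q1 [d1 [i1 [f1 H1]]]] [Q2 [d2 [i2 [f2 H2]]]].
pose d (p : Q1 + Q2) (b : option B) (c : option void) q := match p, q with
  | inl p, inl q => d1 p b c q | inr p, inr q => d2 p b c q
  | inl p, inr q => [/\ f1 p, i2 q, b = None & c = None] | _, _ => False end.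
exists (Q1 + Q2)%type, d, (fun q => if q is inl p then i1 p else False),
  (fun q => if q is inr p then f2 p else False) => x y.
have dr p x' y' q' : run d (inr p) x' y' q' -> exists2 q, q' = inr q & run d2 p x' y' q.
  move e : (inr p) => p' rn; elim: rn p e => [_ p <-|].
    by exists p => //; exact: run_nil.
  move=> q0 b c q1 x0 y0 q2 dp _ IH p e; subst q0; case: q1 dp IH => [q1|q1] //= dp IH.
  by have [q -> rn] := IH _ erefl; exists q => //; exact: run_step dp rn.
have dl p x' y' q' : run d (inl p) x' y' (inr q') ->
    exists u v p1 q1, [/\ x' = u ++ v, run d1 p u [::] p1, f1 p1, i2 q1 & run d2 q1 v [::] q'].
  move e : (inl p) => p'; move e' : (inr q') => q2 rn.
  elim: rn p e q' e' => [_ p <- //|].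
  move=> q0 b c q1 x0 y0 q3 dp rn IH p e q4 e'; subst q0.
  case: q1 dp rn IH => [q1|q1] /= dp rn IH.
    have [u [v [p1 [q5 [-> r1 fp iq r2]]]]] := IH _ erefl _ e'.
    exists (seq_of_opt b ++ u), v, p1, q5; split=> //; first by rewrite catA.
    by have := run_step dp r1; rewrite (seq_void (_ ++ _)).
  case: dp => fp iq -> _; exists [::], x0, p, q1; split=> //; first exact: run_nil.
  by move: rn; rewrite -e' (seq_void y0) => /dr[? [->]].
split=> [[u [v [/(H1 u [::]) [q [q' [iq fq rn]]] /(H2 v [::]) [p [p' [ip fp rn']]] ->]]]|].
  exists (inl q), (inr p'); split=> //; rewrite (seq_void y) -[[::]]/([::] ++ [::]).
  apply: run_cat (run_map (g := inl) (d' := d) _ rn) _ => //.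
  by apply: run_silent (run_map (g := inr) (d' := d) _ rn').
move=> [[q|q] [[q'|q'] [//= iq fq rn]]].
have [u [v [p1 [q1 [-> r1 fp iq1 r2]]]]] := dl _ _ _ _ rn.
by exists u, v; split=> //; [apply/(H1 u [::]); exists q, p1|apply/(H2 v [::]); exists q1, q'].
Qed.

(** The new state [None] is the only initial and the only final one and is visited between
    consecutive factors. [List.In] is used because [B] carries no equality test. *)
Lemma lang_star K : recognizable_lang K ->
  recognizable_lang (fun x => exists2 s, (forall u, List.In u s -> K u) & x = flatten s).
Proof.
move=> [Q [d [i [f H]]]].
pose d' (p : option Q) (b : option B) (c : option void) q := match p, q with
  | Some p, Some q => d p b c q
  | None, Some q => [/\ i q, b = None & c = None]
  | Some p, None => [/\ f p, b = None & c = None] | _, _ => False end.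
exists (option Q), d', (fun q => q = None), (fun q => q = None) => x y.
split=> [[s Ks ->]|].
  exists None, None; split=> //; rewrite (seq_void y).
  elim: s Ks => [|u s IH] Ks; first exact: run_nil.
  have /(H u [::])[q [q' [iq fq rn]]] : K u by apply: Ks; left.
  rewrite -[[::]]/([::] ++ [::]); apply: run_cat (IH _); last by move=> v vs; apply: Ks; right.
  apply: (run_silent (p' := Some q)) => //.
  rewrite -[u]cats0 -[[::]]/([::] ++ [::]).
  apply: run_cat (run_map (g := Some) (d' := d') _ rn) _ => //.
  by apply: run_silent (run_nil _ _).
have main p x' y' q : run d' p x' y' q -> q = None ->
    match p with
    | None => exists2 s, (forall u, List.In u s -> K u) & x' = flatten s
    | Some p => exists u s p', [/\ run d p u [::] p', f p',
        forall u, List.In u s -> K u & x' = u ++ flatten s]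
    end.
  elim=> [_ ->|]; first by exists [::].
  move=> {}p b c p1 {}x' {}y' {}q + _ IH e; move/IH: e.
  case: p p1 {IH} => [p|] [p1|] //=.
  - move=> [u [s [p' [r1 fp Ks ->]]]] dp; exists (seq_of_opt b ++ u), s, p'; split=> //.
      by have := run_step dp r1; rewrite (seq_void (_ ++ _)).
    by rewrite catA.
  - move=> [s Ks ->] [fp -> _]; exists [::], s, p; split=> //; exact: run_nil.
  - move=> [u [s [p' [r1 fp Ks ->]]]] [ip -> _]; exists (u :: s) => // v [<-|/Ks//].
    by apply/(H u [::]); exists p1, p'.
by move=> [_ [_ [-> -> /main]]]; apply.
Qed.

Lemma lang1 (w : seq B) : recognizable_lang (fun x => x = w).
Proof.
elim: w => [|b w IH].
  exists unit, (fun _ _ _ _ => False), (fun=> True), (fun=> True) => x y; split=> [->|].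
    by exists tt, tt; split=> //; rewrite (seq_void y); exact: run_nil.
  by move=> [q [q' [_ _ rn]]]; case: rn.
apply: transduction_ext (lang_cat _ IH (K := fun x => x = [:: b])).
  by move=> x y; split=> [[_ [_ [-> -> ->]]] //|->]; exists [:: b], w.
pose d p b' (c : option void) q := [/\ p = false, q = true, b' = Some b & c = None].
have main p x y q : run d p x y q -> q = true -> if p then x = [::] else x = [:: b].
  elim=> [_ -> //|_ b' c _ {}x {}y {}q [-> -> -> _] _ IHr /IHr /= -> //].
exists bool, d, (fun p => p = false), (fun p => p = true) => x y; split=> [->|].
  exists false, true; split=> //; rewrite (seq_void y).
  by apply: (run1 (b := Some b) (c := None)).
by move=> [p [q [-> fq rn]]]; exact: main rn fq.
Qed.

Lemma lang0 : recognizable_lang (fun _ : seq B => False).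
Proof.
exists unit, (fun _ _ _ _ => False), (fun=> False), (fun=> True) => x y.
by split=> // -[q [q' []]].
Qed.

End LanguageClosure.

(** * Rational and recognisable subsets of a monoid *)

Section RationalImage.
Variables (B : choiceType) (M : monoidType) (sigma : word B -> M).
Hypothesis sigma_morph : surjective_morphism sigma.

Lemma sigma1 : sigma [::] = 1%g. Proof. by case: sigma_morph => -[]. Qed.
Lemma sigmaM u v : sigma (u ++ v) = (sigma u * sigma v)%g.
Proof. by case: sigma_morph => -[_ sM] _; exact: sM. Qed.

Lemma rational_image (X : set M) : rational_subset X ->
  exists2 K : seq B -> Prop, recognizable_lang K & X = sigma @` K.
Proof.
elim=> {X} [X /finite_fsetP[F ->]|X Y _ [K rK ->] _ [L rL ->]|X Y _ [K rK ->] _ [L rL ->]|X _ [K rK ->]].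
- pose pre m := xget [::] (fun w : word B => sigma w = m).
  have preK m : sigma (pre m) = m.
    rewrite /pre; case: xgetP => [w _ //|].
    by have [_ /(_ m)[w <-]] := sigma_morph => /(_ w).
  exists (fun x => exists2 m, m \in enum_fset F & x = pre m).
    elim: (enum_fset F) => [|m s IH].
      by apply: transduction_ext (lang0 B) => x y; split=> // -[].
    apply: transduction_ext (lang_union (lang1 (pre m)) IH) => x y.
    split=> [[->|[m' m's ->]]|[m' + ->]].
    + by exists m => //; exact: mem_head.
    + by exists m' => //; rewrite inE m's orbT.
    + by rewrite inE => /predU1P[->|m's]; [left|right; exists m'].
  apply/seteqP; split=> [m mF|_ [w [m mF ->] <-]]; last by rewrite preK.
  by exists (pre m) => //; exists m.
- exists (fun x => K x \/ L x); first exact: lang_union.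
  by rewrite -image_setU.
- exists (fun x => exists u v, [/\ K u, L v & x = u ++ v]); first exact: lang_cat.
  apply/seteqP; split=> [_ [_ [u Ku <-] [_ [v Lv <-] <-]]|_ [_ [u [v [Ku Lv ->]]] <-]].
    by exists (u ++ v); [exists u, v|rewrite sigmaM].
  by exists (sigma u); [exists u|exists (sigma v); [exists v|rewrite sigmaM]].
- exists (fun x => exists2 s, (forall u, List.In u s -> K u) & x = flatten s).
    exact: lang_star.
  apply/seteqP; split.
    move=> m /(_ [set sigma (flatten s) | s in [set s | forall u, List.In u s -> K u]]) h.
    have [] := h; last first.
      by move=> s Ks <-; exists (flatten s) => //; exists s.
    split; first split.
    + by exists [::] => //=; rewrite sigma1.
    + move=> _ _ [s Ks <-] [t Kt <-]; exists (s ++ t); last by rewrite flatten_cat sigmaM.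
      by move=> u us; case: (List.in_app_or _ _ _ us) => [/Ks|/Kt].
    + move=> _ [u Ku <-]; exists [:: u] => [v [<-|[]] //|]; by rewrite /= cats0.
  move=> _ [_ [s Ks ->] <-] Y [[Y1 YM] KY]; elim: s Ks => [|u s IH] Ks /=.
    by rewrite sigma1.
  rewrite sigmaM; apply: YM; last by apply: IH => v vs; apply: Ks; right.
  by apply: KY; exists u => //; apply: Ks; left.
Qed.

End RationalImage.

(** McKnight's theorem: the automaton is the right Cayley graph of the finite monoid, with edges
    labelled by the generators of [M]. There are finitely many generators, so each label set is
    finite and Kleene's construction applies. *)
Lemma recognisable_rational (B : finType) (M : monoidType) (sigma : word B -> M)
  (sigma_morph : surjective_morphism sigma) (X : set M) :
  recognisable X -> rational_subset X.
Proof.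
move=> [F [phi [P [/finite_fsetP[D FD] [phi1 phiM] ->]]]].
have inD (x : F) : x \in D by have : [set` D] x by rewrite -FD.
pose lab (p q : D) : set M :=
  [set sigma [:: b] | b in [set b | (val p * phi (sigma [:: b]))%g = val q]].
have lab_rat p q : rational_subset (lab p q).
  by apply: rational_finite; apply: finite_image; exact: finite_finset.
have sound p x q : path_product lab p x q -> (val p * phi x)%g = val q.
  elim=> [{}p|{}p _ r y {}q [b /= <- <-] _ <-]; first by rewrite phi1 mulg1.
  by rewrite phiM mulgA.
have complete w p : path_product lab p (sigma w) [` inD (val p * phi (sigma w))%g]%fset.
  elim: w p => [|b w IH] p.
    rewrite (sigma1 sigma_morph) (_ : [` _ ]%fset = p); first exact: path_product_nil.
    by apply: val_inj; rewrite /= phi1 mulg1.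
  rewrite -cat1s (sigmaM sigma_morph).
  apply: (@path_product_cons _ _ _ _ _ [` inD (val p * phi (sigma [:: b]))%g]%fset).
    by exists b.
  have := IH [` inD (val p * phi (sigma [:: b]))%g]%fset.
  rewrite (_ : [` inD (val _ * phi (sigma w))%g]%fset =
    [` inD (val p * phi (sigma [:: b] * sigma w))%g]%fset) //.
  by apply: val_inj; rewrite /= phiM mulgA.
rewrite (_ : phi @^-1` P = \bigcup_(q in [set q : D | P (val q)])
  [set x | path_product lab [` inD 1%g]%fset x q]).
  rewrite bigcup_fset_set; last exact: finite_finset.
  elim/big_rec: _ => [|q Y _]; first by apply: rational_finite.
  by apply: rational_union; exact: path_product_rational.
apply/seteqP; split=> [x /= Px|x [q /= Pq /sound /=]]; last by rewrite mul1g => ->.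
have [_ /(_ x)[w xw]] := sigma_morph; subst x.
exists [` inD (1 * phi (sigma w))%g]%fset => /=; first by rewrite mul1g.
exact: (complete w [` inD 1%g]%fset).
Qed.

Definition endo (T : finType) : Type := {ffun T -> T}.
HB.instance Definition _ (T : finType) := Finite.copy (endo T) {ffun T -> T}.

Section EndoMonoid.
Variable T : finType.
(** The left factor is applied first, as in the action of the monoid on residuals, which thereby
    becomes a morphism. *)
Definition endo_mul (f g : endo T) : endo T := [ffun x => g (f x)].
Definition endo_one : endo T := [ffun x => x].
Lemma endo_mulA : associative endo_mul.
Proof. by move=> f g h; apply/ffunP => x; rewrite !ffunE. Qed.
Lemma endo_mul1 : left_id endo_one endo_mul.
Proof. by move=> f; apply/ffunP => x; rewrite !ffunE. Qed.
Lemma endo_mulr1 : right_id endo_one endo_mul.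
Proof. by move=> f; apply/ffunP => x; rewrite !ffunE. Qed.
HB.instance Definition _ := isMonoid.Build (endo T) endo_mulA endo_mul1 endo_mulr1.
End EndoMonoid.

Lemma dfa_recognisable (B : finType) (M : monoidType) (sigma : word B -> M)
  (sigma_morph : surjective_morphism sigma) (X : set M) :
  dfa (fun w => X (sigma w)) -> recognisable X.
Proof.
move=> [Q [d [i [f H]]]].
(* The monoid acts on the finitely many residuals of [X]. *)
pose res x : set M := [set y | X (x * y)%g].
have /finite_fsetP[D resD] : finite_set (range res).
  have [g gK] : exists g, cancel g sigma.
    have [_ s] := sigma_morph; have [g gK] := choice s; by exists g.
  (* A residual depends only on the state reached by a chosen word for [x]. *)
  apply: (@sub_finite_set _ _ [set [set y | f (foldl d q (g y))] | q in [set: Q]]).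
    move=> _ [x _ <-]; exists (foldl d i (g x)) => //.
    by apply/seteqP; split=> y /=; rewrite -foldl_cat -H (sigmaM sigma_morph) !gK.
  by apply: finite_image; exact: finite_finset.
have inD x : res x \in D by have : [set` D] (res x) by rewrite -resD; exists x.
have actD m (Y : D) : [set y | val Y (m * y)%g] \in D.
  have : [set` D] (val Y) by exact: valP.
  rewrite -resD => -[x _ <-]; rewrite (_ : [set y | _] = res (x * m)%g) //.
  by apply/seteqP; split=> y /=; rewrite /res /= mulgA.
pose x0 : D := [` inD 1%g]%fset.
exists (endo D), (fun m => [ffun Y : D => [` actD m Y]%fset]),
  [set h : endo D | val (h x0) 1%g]; split.
- exact: finite_finset.
- split=> [|m n]; apply/ffunP => Y; apply: val_inj; rewrite !ffunE /=.
    by apply/seteqP; split=> y /=; rewrite mul1g.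
  by apply/seteqP; split=> y /=; rewrite mulgA.
- by apply/seteqP; split=> m; rewrite /preimage /= ffunE /= /res /= mul1g mulg1.
Qed.

(** * Multiplication tables as context-free languages *)

Lemma split_join_transduction (B : Type) (L : seq B -> Prop) : dfa L ->
  transduction (fun (x : seq (option B)) (y : seq B) => exists u v,
    [/\ x = map Some u ++ None :: map Some v, L u, L v & y = u ++ v]).
Proof.
move=> [Q [dl [i [f H]]]].
(* The Boolean tells whether the separator has been read; there the first word is tested and the
   automaton restarts. *)
pose d (p : bool * Q) (b : option (option B)) (c : option B) (q : bool * Q) :=
  match b with
  | Some (Some a) => c = Some a /\ q = (p.1, dl p.2 a)
  | Some None => [/\ p.1 = false, f p.2, c = None & q = (true, i)]
  | None => False end.
have copy p u : run d p (map Some u) u (p.1, foldl dl p.2 u).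
  elim: u p => [|a u IH] [s p]; first exact: run_nil.
  rewrite -[map _ _]/(seq_of_opt (Some (Some a)) ++ map Some u) -[a :: u]/(seq_of_opt (Some a) ++ u).
  by apply: run_step (IH (s, dl p a)).
have inv p x y q : run d p x y q -> q.1 = true -> f q.2 ->
    if p.1 then x = map Some y /\ f (foldl dl p.2 y) else
    exists u v, [/\ x = map Some u ++ None :: map Some v, f (foldl dl p.2 u),
      f (foldl dl i v) & y = u ++ v].
  elim=> [{}q -> //|{}p [[a|]|//] c q1 {}x {}y {}q /= + _ IHr q1t fq].
    case: p => s p /= [-> e]; move: IHr => /(_ q1t fq); rewrite e /=.
    case: s {e} => [[-> //]|[u [v [-> fu fv ->]]]].
    by exists (a :: u), v.
  case: p => s p /= [-> fp -> e]; move: IHr => /(_ q1t fq); rewrite e /= => -[-> fy].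
  by exists [::], y.
exists (bool * Q)%type, d, (fun p => p = (false, i)), (fun p => p.1 = true /\ f p.2) => x y.
split=> [[u [v [-> /H fu /H fv ->]]]|[_ [q [-> [q1 fq] rn]]]].
  exists (false, i), (true, foldl dl i v); split=> //.
  apply: run_cat (copy (false, i) u) _ => /=.
  by apply: (@run_step _ _ _ _ _ (Some None) None _ _ _ _ _ (copy (true, i) v)).
by have [u [v [-> fu fv ->]]] := inv _ _ _ _ rn q1 fq; exists u, v; split=> //; apply/H.
Qed.

Lemma inr_map_no_inl (N T : Type) (a : seq T) (m : N) x y :
  map inr a = x ++ inl m :: y -> False.
Proof. by elim: a x => [|t a IH] [|e x] //= [_ e']; exact: IH e'. Qed.

Lemma inr_map_cat_inl (N T : Type) (a g : seq T) (n m : N) x y :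
  map inr a ++ inl n :: map inr g = x ++ inl m :: y ->
  [/\ x = map inr a, m = n & y = map inr g].
Proof.
elim: a x => [|t a IH] [|e x] //=.
- by case=> -> ->.
- by case=> _ e'; case: (inr_map_no_inl e').
- by case=> <- /IH[-> -> ->].
Qed.

Lemma cfg_context (T : eqType) (G : cfg T) a s t g :
  clos_refl_trans _ (@cfg_step T G) s t ->
  clos_refl_trans _ (@cfg_step T G) (a ++ s ++ g) (a ++ t ++ g).
Proof.
elim=> [_ _ [x y N rhs inG]|u|u v w _ h1 _ h2].
- apply: rt_step; rewrite -!catA !catA -(catA _ (_ :: _)) -!catA /=.
  by have := Cfg_step (a ++ x) (y ++ g) inG; rewrite -!catA.
- exact: rt_refl.
- exact: rt_trans h1 h2.
Qed.

(** A transition reading [b] and writing [c] becomes a production with [b] to the left and [c] to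
    the right of the next state. The letters on the right come out in reverse order, which matches
    the reversal in the multiplication language. *)
Lemma transduction_context_free (B : finType)
    (R : seq (option B) -> seq B -> Prop) : transduction R ->
  context_free [set z | exists x y, R x y /\ z = x ++ None :: map Some (rev y)].
Proof.
move=> [Q [d [i [f H]]]].
pose N := option Q; have rev_opt (c : option B) : rev (seq_of_opt c) = seq_of_opt c by case: c.
pose body (t : Q * option (option B) * option B * Q) : seq (N + option B) :=
  map inr (seq_of_opt t.1.1.2) ++
  inl (Some t.2) :: map inr (map Some (seq_of_opt t.1.2)).
pose rules : seq (N * seq (N + option B)) :=
  [seq (None, [:: inl (Some q)]) | q <- enum Q & `[< i q >]] ++
  [seq (Some t.1.1.1, body t) | t <- enum {: Q * option (option B) * option B * Q}
     & `[< d t.1.1.1 t.1.1.2 t.1.2 t.2 >]] ++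
  [seq (Some q, [:: inr None]) | q <- enum Q & `[< f q >]].
pose G := @Cfg (option B) (option Q : finType) None rules.
have rule_init q : i q -> (None, [:: inl (Some q)]) \in rules.
  move=> iq; rewrite mem_cat; apply/orP; left; apply/mapP; exists q => //.
  by rewrite mem_filter mem_enum andbT; exact/asboolP.
have rule_step p b c q : d p b c q -> (Some p, body (p, b, c, q)) \in rules.
  move=> dp; rewrite !mem_cat; apply/orP; right; apply/orP; left; apply/mapP.
  by exists (p, b, c, q) => //; rewrite mem_filter mem_enum andbT; exact/asboolP.
have rule_final q : f q -> (Some q, [:: inr None]) \in rules.
  move=> fq; rewrite !mem_cat; apply/orP; right; apply/orP; right; apply/mapP; exists q => //.
  by rewrite mem_filter mem_enum andbT; exact/asboolP.
pose lang (n : N) (z : seq (option B)) := exists q x y q',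
  [/\ (if n is Some p then q = p else i q), f q', run d q x y q' &
    z = x ++ None :: map Some (rev y)].
(* The grammar is linear, so the induction only has to follow sentential forms with at most one
   nonterminal. *)
have sound s w : clos_refl_trans_1n _ (@cfg_step _ G) s (map inr w) ->
    (forall a n g, s = map inr a ++ inl n :: map inr g ->
      exists2 z, lang n z & w = a ++ z ++ g) /\
    (forall a, s = map inr a -> w = a).
  move e : (map inr w) => t st; elim: st e => [{}s es|{}s s' {}t st _ IH et].
    subst s; split=> [a n g ew|a]; first by case: (inr_map_no_inl ew).
    by apply: inj_map => ? ? [].
  have [IH1 IH2] := IH et; case: st {IH} IH1 IH2 => x y n rhs inG IH1 IH2.
  split; last by move=> a ea; case: (inr_map_no_inl (esym ea)).
  move=> a n' g ea; have [ex en ey] := inr_map_cat_inl (esym ea); subst x y n'.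
  move: inG; rewrite !mem_cat => /or3P[] /mapP[].
  - move=> q; rewrite mem_filter => /andP[/asboolP iq _] [en er]; subst n rhs.
    have [z [q0 [x [y [q' [-> fq' rn ->]]]]] ->] := IH1 a (Some q) g erefl.
    by exists (x ++ None :: map Some (rev y)) => //; exists q, x, y, q'.
  - move=> [[[p b] c] q]; rewrite mem_filter => /andP[/asboolP /= dp _] [en er]; subst n rhs.
    have [|z [q0 [x [y [q' [-> fq' rn ->]]]]] ->] :=
      IH1 (a ++ seq_of_opt b) (Some q) (map Some (seq_of_opt c) ++ g).
      by rewrite /body /= !map_cat -!catA /= .
    exists ((seq_of_opt b ++ x) ++ None :: map Some (rev (seq_of_opt c ++ y))).
      by exists p, (seq_of_opt b ++ x), (seq_of_opt c ++ y), q'; split=> //; exact: run_step dp rn.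
    by rewrite rev_cat rev_opt map_cat -!catA /= -!catA.
  - move=> q; rewrite mem_filter => /andP[/asboolP fq _] [en er]; subst n rhs.
    exists [:: None].
      by exists q, [::], [::], q; split=> //; exact: run_nil.
    by apply: IH2; rewrite map_cat.
have complete p x y q : run d p x y q -> f q ->
    clos_refl_trans _ (@cfg_step _ G) [:: inl (Some p)] (map inr (x ++ None :: map Some (rev y))).
  elim=> [{}q fq|{}p b c q1 {}x {}y {}q dp _ IH fq].
    apply: rt_step; have := @Cfg_step _ G [::] [::] (Some q) [:: inr None].
    by apply; exact: rule_final.
  apply: (rt_trans _ _ _ (body (p, b, c, q1))).
    apply: rt_step; have := @Cfg_step _ G [::] [::] (Some p) (body (p, b, c, q1)).
    by rewrite cats0; apply; exact: rule_step.
  have := cfg_context (map inr (seq_of_opt b)) (map inr (map Some (seq_of_opt c))) (IH fq).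
  by rewrite /body /= rev_cat rev_opt !map_cat /= !map_cat -!catA.
exists G; apply/seteqP; split=> z.
  move=> [x [y [/H[q [q' [iq fq rn]]] ->]]].
  apply: (rt_trans _ _ _ [:: inl (Some q)]); last exact: complete rn fq.
  apply: rt_step; have := @Cfg_step _ G [::] [::] None [:: inl (Some q)].
  by apply; exact: rule_init.
move=> st; have [/(_ [::] None [::] erefl)[w lw ->] _] := sound _ _ (clos_rt_rt1n _ _ _ _ st).
have [q [x [y [q' [/= iq fq rn ->]]]]] := lw.
by exists x, y; split; [apply/H; exists q, q'|rewrite cats0].
Qed.

(** * Consequences of a normal form computed by a transducer *)

Section RationalMonoid.
Variables (B : finType) (M : monoidType) (sigma : word B -> M) (beta : word B -> word B).
Hypothesis sigma_morph : surjective_morphism sigma.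
Hypothesis beta_transduction : transduction (fun u v => v = beta u).
Hypothesis sigma_beta : forall w, sigma (beta w) = sigma w.
Hypothesis beta_sigma : forall u v, sigma u = sigma v -> beta u = beta v.

Lemma beta_eq u v : beta u = beta v <-> sigma u = sigma v.
Proof. by split=> [e|/beta_sigma //]; rewrite -(sigma_beta u) e sigma_beta. Qed.

Lemma same_image_transduction : transduction (fun u v => sigma u = sigma v).
Proof.
apply: transduction_ext (transduction_comp beta_transduction (transduction_inv beta_transduction)).
by move=> u v; rewrite -beta_eq; split=> [[_ -> //]|e]; exists (beta u).
Qed.

(** All words representing elements of [X] are obtained from a regular [K] with image [X] by
    composing the kernel of [sigma] with [K]; this full preimage is again regular, so
    [dfa_recognisable] applies. *)
Lemma rational_recognisable (X : set M) : rational_subset X -> recognisable X.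
Proof.
move=> /(rational_image sigma_morph)[K rK ->]; apply: (dfa_recognisable sigma_morph).
apply: lang_dfa; apply: transduction_ext (transduction_comp same_image_transduction rK).
by move=> x y; split=> [[v]|[v]]; exists v.
Qed.

Lemma rational_rational_monoid : rational_monoid M.
Proof. by exists B, sigma, beta; split=> //; exact: transduction_rational. Qed.

Lemma rational_kleene : kleene_analogue M.
Proof.
move=> X; split; first exact: rational_recognisable.
exact: (recognisable_rational sigma_morph).
Qed.

Lemma rational_boolean : boolean_algebra_of_rational_subsets M.
Proof.
split=> [X Y|X Y /rational_kleene rX /rational_kleene rY|X /rational_kleene rX].
- exact: rational_union.
- apply/rational_kleene; case: rX rY => [F [phi [P [finF [phi1 phiM] ->]]]].
  move=> [G [psi [R [finG [psi1 psiM] ->]]]].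
  exists (F * G)%type, (fun x => (phi x, psi x)), (P `*` R); split=> //.
    by rewrite -setXTT; exact: finite_setX.
  by split=> [|x y]; rewrite ?phi1 ?psi1 ?phiM ?psiM.
- apply/rational_kleene; case: rX => [F [phi [P [finF phi_morph ->]]]].
  by exists F, phi, (~` P); split=> //; rewrite preimage_setC.
Qed.

(** The normal forms: [sigma] is injective on them, so equality of elements is the identity relation
    and a product is computed by [beta] after concatenation. *)
Let L : set (word B) := range beta.

Lemma beta_id u : L u -> beta u = u.
Proof. by move=> [v _ <-]; apply: beta_sigma; exact: sigma_beta. Qed.

Lemma dfa_range : dfa L.
Proof.
have [Q [d [i [f H]]]] := dfa_dom (transduction_inv beta_transduction).
exists Q, d, i, f => w; rewrite -H.
by split=> [[u _ <-]|[u ->]]; exists u.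
Qed.

Lemma sigma_range : sigma @` L = [set: M].
Proof.
apply/seteqP; split=> // x _; have [_ /(_ x)[w <-]] := sigma_morph.
by exists (beta w); [exists w|].
Qed.

Lemma append_transduction (b : B) : transduction (fun u v => v = u ++ [:: b]).
Proof.
pose d p (c e : option B) q := p = false /\
  if q then c = None /\ e = Some b else exists a, c = Some a /\ e = Some a.
exists bool, d, (fun p => p = false), (fun p => p = true) => x y; split=> [->|].
  exists false, true; split=> //; elim: x => [|a x IH] /=.
    by apply: (run1 (b := None) (c := Some b)).
  rewrite -[a :: x]/(seq_of_opt (Some a) ++ x) -[a :: _]/(seq_of_opt (Some a) ++ (x ++ [:: b])).
  by apply: run_step IH; split=> //; exists a.
have main p u v q : run d p u v q -> q = true ->
    if p then u = [::] /\ v = [::] else v = u ++ [:: b].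
  elim=> [_ -> //|_ c e [] {}u {}v {}q [-> /=] + _ IH /IH /= + ].
    by move=> [-> ->] [-> ->].
  by move=> [a [-> ->]] ->.
by move=> [p [q [-> fq rn]]]; exact: main rn fq.
Qed.

Lemma rational_asynchronous : asynchronous_automatic M.
Proof.
exists B, sigma, L; split=> //; [exact: (dfa_regular dfa_range)|exact: sigma_range| |].
  apply: transduction_rational; apply: transduction_ext (dfa_transduction dfa_range).
  move=> u v; split=> [[-> //]|[Lu Lv e]]; split=> //.
  by rewrite -(beta_id Lu) -(beta_id Lv); exact/esym/beta_eq.
move=> b; apply: transduction_rational.
have T := transduction_comp (dfa_transduction dfa_range)
  (transduction_comp (append_transduction b) beta_transduction).
apply: transduction_ext T => u v; split.
  move=> [_ [-> Lu] [_ -> ->]]; by split=> //; exists (u ++ [:: b]).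
move=> [Lu Lv e]; exists u => //; exists (u ++ [:: b]) => //.
by rewrite -(beta_id Lv); exact/esym/beta_eq.
Qed.

Lemma rational_word_hyperbolic : word_hyperbolic M.
Proof.
exists B, sigma, L; split=> //; [exact: (dfa_regular dfa_range)|exact: sigma_range|].
have T := transduction_comp (split_join_transduction dfa_range) beta_transduction.
have [G HG] := transduction_context_free T; exists G; rewrite -HG.
apply/seteqP; split=> z.
  move=> [u [v [w [Lu Lv Lw e ->]]]].
  exists (map Some u ++ None :: map Some v), w; split; last by rewrite -catA.
  exists (u ++ v); first by exists u, v.
  rewrite -(beta_id Lw); apply/beta_eq.
  by rewrite -e (sigmaM sigma_morph).
move=> [_ [_ [[_ [u [v [-> Lu Lv ->]]] ->] ->]]].
exists u, v, (beta (u ++ v)); split=> //; first by exists (u ++ v).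
  by rewrite sigma_beta (sigmaM sigma_morph).
by rewrite -catA.
Qed.

End RationalMonoid.

(** * Computability in the WHILE language *)

(* The program may start from any store and leaves the variables from [m] on
   alone, so that programs can be composed without renaming variables. *)
Definition computable (f : tree -> tree) : Prop := exists c m, 0 < m /\
  forall s, exists s', [/\ while_exec c s s', s' 0 = f (s 0) & forall x, m <= x -> s' x = s x].

Lemma computable_ext f g : f =1 g -> computable f -> computable g.
Proof.
move=> fg [c [m [m0 H]]]; exists c, m; split=> // s; have [s' [h1 h2 h3]] := H s.
by exists s'; split=> //; rewrite h2 fg.
Qed.

Lemma computable_expr e f : (forall s, while_eval s e = f (s 0)) -> computable f.
Proof.
move=> ef; exists (CAssign 0 e), 1; split=> // s.
exists (store_set s 0 (while_eval s e)); split; [exact: exec_assign|by rewrite /store_set ef|].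
by case.
Qed.

Lemma computable_id : computable (fun t => t).
Proof. exact: (@computable_expr (EVar 0)). Qed.

Lemma computable_const t : computable (fun=> t).
Proof.
have [e he] : exists e, forall s, while_eval s e = t.
  elim: t => [|l [e1 h1] r [e2 h2]]; first by exists ELeaf.
  by exists (ENode e1 e2) => s /=; rewrite h1 h2.
exact: (@computable_expr e).
Qed.

Lemma computable_comp f g : computable f -> computable g -> computable (fun t => g (f t)).
Proof.
move=> [c [m [m0 H]]] [c' [m' [m0' H']]]; exists (CSeq c c'), (maxn m m'); split; first by lia.
move=> s; have [s1 [e1 v1 u1]] := H s; have [s2 [e2 v2 u2]] := H' s1.
exists s2; split; [exact: exec_seq e1 e2|by rewrite v2 v1|].
by move=> x; rewrite geq_max => /andP[h h']; rewrite u2 // u1.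
Qed.

Lemma computable_hd f : computable f -> computable (fun t => tree_hd (f t)).
Proof. by move=> /computable_comp; apply; exact: (@computable_expr (EHd (EVar 0))). Qed.

Lemma computable_tl f : computable f -> computable (fun t => tree_tl (f t)).
Proof. by move=> /computable_comp; apply; exact: (@computable_expr (ETl (EVar 0))). Qed.

(** Total correctness with the postcondition as a continuation: a goal is reduced command by
    command. *)
Definition reaches (c : while_cmd) (s : store) (post : store -> Prop) : Prop :=
  exists2 s', while_exec c s s' & post s'.

Lemma reaches_seq c c' s post :
  reaches c s (fun s' => reaches c' s' post) -> reaches (CSeq c c') s post.
Proof. by move=> [s1 e1 [s2 e2 p]]; exists s2 => //; exact: exec_seq e1 e2. Qed.

Lemma reaches_assign x e s (post : store -> Prop) :
  post (store_set s x (while_eval s e)) -> reaches (CAssign x e) s post.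
Proof. by move=> p; exists (store_set s x (while_eval s e)) => //; exact: exec_assign. Qed.

Lemma reaches_call c m f s (post : store -> Prop) :
  (forall s, exists s', [/\ while_exec c s s', s' 0 = f (s 0) & forall x, m <= x -> s' x = s x]) ->
  (forall s', s' 0 = f (s 0) -> (forall x, m <= x -> s' x = s x) -> post s') ->
  reaches c s post.
Proof. by move=> H p; have [s' [e v u]] := H s; exists s' => //; exact: p. Qed.

Lemma computable_reaches f c m : 0 < m ->
  (forall s, reaches c s (fun s' => s' 0 = f (s 0) /\ forall x, m <= x -> s' x = s x)) ->
  computable f.
Proof.
move=> m0 H; exists c, m; split=> // s; have [s' e [v u]] := H s.
by exists s'; split.
Qed.

Lemma store_setE s x t y : store_set s x t y = if y == x then t else s y.
Proof. by []. Qed.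

Lemma store_set_eq s x t : store_set s x t x = t.
Proof. by rewrite store_setE eqxx. Qed.

Lemma store_set_neq s x t y : y <> x -> store_set s x t y = s y.
Proof. by rewrite store_setE => /eqP/negbTE ->. Qed.

Lemma computable_node f g : computable f -> computable g ->
  computable (fun t => Node (f t) (g t)).
Proof.
move=> [c [m [m0 H]]] [c' [m' [m0' H']]]; pose n := maxn m m'.
have [mn mn'] : m <= n /\ m' <= n by rewrite /n; lia.
apply: (@computable_reaches _ (CSeq (CAssign n (EVar 0)) (CSeq c (CSeq (CAssign n.+1 (EVar 0))
  (CSeq (CAssign 0 (EVar n)) (CSeq c' (CAssign 0 (ENode (EVar n.+1) (EVar 0)))))))) n.+2) => // s.
apply: reaches_seq; apply: reaches_assign; apply: reaches_seq.
apply: (reaches_call H) => s1; rewrite store_set_neq /=; last by lia.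
move=> v1 u1; apply: reaches_seq; apply: reaches_assign; apply: reaches_seq.
apply: reaches_assign; apply: reaches_seq; apply: (reaches_call H') => s2.
rewrite store_set_eq /= store_set_neq; last by lia.
rewrite u1 // store_set_eq => v2 u2; apply: reaches_assign => /=.
rewrite store_set_eq v2 u2; last by lia.
rewrite !(store_set_eq, store_set_neq) ?v1; try lia; split=> // x xn.
rewrite store_set_neq; last by lia.
rewrite u2; last by lia.
rewrite !store_set_neq; try lia.
by rewrite u1; [rewrite store_set_neq //; lia|lia].
Qed.

(* The step gets the environment, so that steps of nested loops can reach the items
   of the enclosing loops by descending to the left. *)
Fixpoint tree_fold (step : tree -> tree) (env acc l : tree) : tree :=
  if l is Node x l' then tree_fold step env (step (Node env (Node acc x))) l' else acc.

Lemma computable_fold a l step : computable a -> computable l -> computable step ->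
  computable (fun t => tree_fold step t (a t) (l t)).
Proof.
move=> ca cl [c [m [m0 H]]]; pose n := m.
suff loop : computable (fun u => tree_fold step (tree_hd u) (tree_hd (tree_tl u)) (tree_tl (tree_tl u))).
  have h : computable (fun t => Node t (Node (a t) (l t))).
    by apply: computable_node; [exact: computable_id|exact: computable_node].
  exact: computable_comp h loop.
(* Variables [m], [m.+1] and [m.+2] hold the environment, the accumulator and the rest of the list;
   the program [c] of the step does not change them. *)
pose body := CSeq (CAssign 0 (ENode (EVar m) (ENode (EVar m.+1) (EHd (EVar m.+2)))))
  (CSeq c (CSeq (CAssign m.+1 (EVar 0)) (CAssign m.+2 (ETl (EVar m.+2))))).
have main L : forall s, s m.+2 = L -> reaches (CWhile (EVar m.+2) body) s (fun s' =>
    s' m.+1 = tree_fold step (s m) (s m.+1) L /\ forall x, m.+3 <= x -> s' x = s x).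
  elim: L => [|x _ L IH] s sL; first by exists s; [exact: exec_while_false|].
  have [s1 e1 [v1 w1 z1 u1]] : reaches body s (fun s' => [/\ s' m = s m,
      s' m.+1 = step (Node (s m) (Node (s m.+1) x)), s' m.+2 = L & forall x, m.+3 <= x -> s' x = s x]).
    apply: reaches_seq; apply: reaches_assign; apply: reaches_seq.
    apply: (reaches_call H) => s1; rewrite store_set_eq /= sL /= => v1 u1.
    apply: reaches_seq; apply: reaches_assign; apply: reaches_assign.
    have e0 y : m <= y -> s1 y = s y by move=> my; rewrite u1 // store_set_neq //; lia.
    by split=> [||| y my]; rewrite /= !(store_set_eq, store_set_neq) ?v1 ?e0 ?sL //; lia.
  have [s2 e2 [v2 u2]] := IH s1 z1.
  exists s2; first by apply: exec_while_true e1 e2; rewrite /= sL.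
  by split=> [|y my]; [rewrite v2 v1 w1|rewrite u2 // u1].
apply: (@computable_reaches _ (CSeq (CAssign m (EHd (EVar 0)))
  (CSeq (CAssign m.+1 (EHd (ETl (EVar 0)))) (CSeq (CAssign m.+2 (ETl (ETl (EVar 0))))
  (CSeq (CWhile (EVar m.+2) body) (CAssign 0 (EVar m.+1)))))) m.+3) => // s.
do 3 (apply: reaches_seq; apply: reaches_assign); apply: reaches_seq.
set s0 := store_set _ m.+2 _; have [s1 e1 [v1 u1]] := main _ s0 erefl.
exists s1; first exact: e1.
apply: reaches_assign; split=> [|x mx].
  by rewrite store_set_eq /= v1 /s0 /= !(store_set_eq, store_set_neq) //; lia.
by rewrite store_set_neq ?u1 /s0 ?store_set_neq //; lia.
Qed.

(** A conditional is a loop over [tree_of_bool], which is a list of length at most one: the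
    accumulator starts with [g t], and the step discards it and applies [f] to the environment. *)
Lemma computable_ifeq a b f g : computable a -> computable b -> computable f -> computable g ->
  computable (fun t => if tree_eqb (a t) (b t) then f t else g t).
Proof.
move=> ca cb cf cg.
have ceq : computable (fun t => tree_of_bool (tree_eqb (a t) (b t))).
  pose g0 u := tree_of_bool (tree_eqb (tree_hd u) (tree_tl u)).
  apply: (@computable_comp _ g0 (computable_node ca cb)).
  exact: (@computable_expr (EEq (EHd (EVar 0)) (ETl (EVar 0)))).
apply: computable_ext (computable_fold cg ceq (computable_comp (computable_hd computable_id) cf)) => t.
by case: (tree_eqb _ _).
Qed.

(** * Rational subset membership *)

Ltac computability := repeat first
  [ exact: computable_id | exact: computable_const | assumption
  | apply: computable_hd | apply: computable_tl | apply: computable_node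
  | apply: computable_ifeq | apply: computable_fold ].

Lemma tree_eqbP s t : reflect (s = t) (tree_eqb s t).
Proof.
elim: s t => [|s1 IH1 s2 IH2] [|t1 t2] /=; try by constructor.
by apply: (iffP andP) => [[/IH1 -> /IH2 ->]|[<- <-]] //; split; [apply/IH1|apply/IH2].
Qed.

Lemma tree_eqb_code (T : eqType) (code : T -> tree) (x y : T) :
  injective code -> tree_eqb (code x) (code y) = (x == y).
Proof. by move=> inj; apply/tree_eqbP/eqP => [/inj|->]. Qed.

Lemma code_nat_inj : injective code_nat.
Proof. by elim=> [|m IH] [|n] //= [/IH ->]. Qed.

Definition code_fin (T : finType) (x : T) : tree := code_nat (enum_rank x).

Lemma code_fin_inj (T : finType) : injective (@code_fin T).
Proof. by move=> x y /code_nat_inj/val_inj/enum_rank_inj. Qed.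

Definition code_opt (B : finType) (b : option B) : tree :=
  if b is Some a then Node (code_letter a) Leaf else Leaf.

Lemma code_opt_inj (B : finType) : injective (@code_opt B).
Proof. by move=> [a|] [b|] //= [/code_fin_inj ->]. Qed.

Lemma tree_fold_code (X Y : Type) (cx : X -> tree) (cy : Y -> tree) step env (g : Y -> X -> Y) y s :
  (forall y x, step (Node env (Node (cy y) (cx x))) = cy (g y x)) ->
  tree_fold step env (cy y) (code_seq cx s) = cy (foldl g y s).
Proof. by move=> h; elim: s y => //= x s IH y; rewrite h IH. Qed.

Lemma mem_foldl (X Y : eqType) (f : seq Y -> X -> seq Y) (R : X -> Y -> Prop) acc s y :
  (forall acc x y, y \in f acc x <-> y \in acc \/ R x y) ->
  y \in foldl f acc s <-> y \in acc \/ exists2 x, x \in s & R x y.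
Proof.
move=> h; elim: s acc => [|x s IH] acc /=; first by split=> [|[//|[]//]]; left.
rewrite IH h; split=> [[[|r]|[z zs r]]|[|[z]]].
- by left.
- by right; exists x; rewrite ?mem_head.
- by right; exists z => //; rewrite inE zs orbT.
- by left; left.
- by rewrite inE => /predU1P[->|zs] r; [left; right|right; exists z].
Qed.

(** * Search in the product of a transducer and an NFA, with its program *)

Section Configurations.
Variables (P B : finType).
Notation conf := (P * nat)%type.
Notation rule := (P * option B * option B * P)%type.
Notation transition := (nat * B * nat)%type.
Variable D : seq rule.

(** A rule with an output letter fires together with an NFA transition reading it, a rule without
    output leaves the NFA in place. The nested conditionals follow the tests of [move_step]. *)
Definition move (b : option B) (t : rule) (e : conf) (x : option transition) : option conf :=
  if t.1.1.1 == e.1 then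
    if t.1.1.2 == b then
      if x is Some y then
        if y.1.1 == e.2 then if t.1.2 == Some y.1.2 then Some (t.2, y.2) else None else None
      else if t.1.2 == None then Some (t.2, e.2) else None
    else None
  else None.

Definition add_move b t e (acc : seq conf) x :=
  if move b t e x is Some e' then e' :: acc else acc.

(* [None] stands for the NFA staying put. *)
Definition pass b (T : seq transition) (acc S : seq conf) : seq conf :=
  foldl (fun acc t => foldl (fun acc e =>
    foldl (add_move b t e) acc (None :: map Some T)) acc S) acc D.

Lemma mem_pass b T acc S e' : e' \in pass b T acc S <->
  e' \in acc \/ exists2 t, t \in D & exists2 e, e \in S &
    exists2 x, x \in None :: map Some T & move b t e x = Some e'.
Proof.
apply: (@mem_foldl _ _ _ (fun t e' => exists2 e, e \in S &
  exists2 x, x \in None :: map Some T & move b t e x = Some e')) => {}acc t {}e'.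
apply: (@mem_foldl _ _ _ (fun e e' =>
  exists2 x, x \in None :: map Some T & move b t e x = Some e')) => {}acc e {}e'.
apply: (@mem_foldl _ _ _ (fun x e' => move b t e x = Some e')) => {}acc x {}e'.
rewrite /add_move; case: move => [z|]; last first.
  by split=> [|[]//]; left.
by rewrite inE; split=> [/predU1P[->|]|[->|[->]]]; rewrite ?eqxx ?orbT //; [right|left].
Qed.

Definition code_conf (e : conf) : tree := Node (code_fin e.1) (code_nat e.2).

Lemma code_conf_inj : injective code_conf.
Proof. by move=> [p m] [q n] [/code_fin_inj -> /code_nat_inj ->]. Qed.

Definition code_rule (t : rule) : tree :=
  Node (code_fin t.1.1.1) (Node (code_opt t.1.1.2) (Node (code_opt t.1.2) (code_fin t.2))).

(** [Leaf] is free to stand for [None], since a coded transition is a node. *)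
Definition code_ext (x : option transition) : tree :=
  if x is Some y then code_transition y else Leaf.

Let get_acc t := tree_hd (tree_tl t).
Let get_item t := tree_tl (tree_tl t).
Let get_input u := tree_hd (tree_tl u).
Let get_confs u := tree_hd (tree_tl (tree_tl u)).
Let get_exts u := tree_tl (tree_tl (tree_tl u)).

Definition move_step (t3 : tree) : tree :=
  let x := get_item t3 in
  let e := get_item (tree_hd t3) in
  let t := get_item (tree_hd (tree_hd t3)) in
  let b := get_input (tree_hd (tree_hd (tree_hd t3))) in
  if tree_eqb (tree_hd t) (tree_hd e) then
    if tree_eqb (tree_hd (tree_tl t)) b then
      if tree_eqb x Leaf then
        if tree_eqb (tree_hd (tree_tl (tree_tl t))) Leaf then
          Node (Node (tree_tl (tree_tl (tree_tl t))) (tree_tl e)) (get_acc t3)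
        else get_acc t3
      else if tree_eqb (tree_hd x) (tree_tl e) then
        if tree_eqb (tree_hd (tree_tl (tree_tl t))) (Node (tree_hd (tree_tl x)) Leaf) then
          Node (Node (tree_tl (tree_tl (tree_tl t))) (tree_tl (tree_tl x))) (get_acc t3)
        else get_acc t3
      else get_acc t3
    else get_acc t3
  else get_acc t3.

Definition conf_step (t2 : tree) : tree :=
  tree_fold move_step t2 (get_acc t2) (get_exts (tree_hd (tree_hd t2))).

Definition rule_step (t1 : tree) : tree :=
  tree_fold conf_step t1 (get_acc t1) (get_confs (tree_hd t1)).

Definition pass_tree (u : tree) : tree :=
  tree_fold rule_step u (tree_hd u) (code_seq code_rule D).

Lemma computable_pass : computable pass_tree.
Proof.
have c3 : computable move_step by rewrite /move_step /get_acc /get_item /get_input; computability.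
have c2 : computable conf_step by rewrite /conf_step /get_acc /get_exts; computability.
have c1 : computable rule_step by rewrite /rule_step /get_acc /get_confs; computability.
by rewrite /pass_tree; computability.
Qed.

Definition code_exts (T : seq transition) : tree := Node Leaf (code_seq (@code_transition B) T).

Lemma code_extsE T : code_exts T = code_seq code_ext (None :: map Some T).
Proof. by rewrite /code_exts /=; congr Node; elim: T => //= x T ->. Qed.

Lemma pass_tree_code b T acc S :
  pass_tree (Node (code_seq code_conf acc)
    (Node (code_opt b) (Node (code_seq code_conf S) (code_exts T)))) =
  code_seq code_conf (pass b T acc S).
Proof.
rewrite /pass_tree [tree_hd _]/=; apply: (tree_fold_code (cy := code_seq code_conf)) => acc1 t.
rewrite /rule_step /get_acc /get_confs [tree_hd _]/= [X in tree_fold _ _ _ X]/=.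
apply: (tree_fold_code (cy := code_seq code_conf)) => acc2 e.
rewrite /conf_step /get_acc /get_exts [tree_hd _]/= [X in tree_fold _ _ _ X]/= code_extsE.
apply: (tree_fold_code (cy := code_seq code_conf)) => acc3 x.
rewrite /move_step /get_acc /get_item /get_input /= /add_move /move.
rewrite (tree_eqb_code _ _ (@code_fin_inj P)) (tree_eqb_code _ _ (@code_opt_inj B)).
case: ifP => // _; case: ifP => // _; case: x => [[[n a] n']|] /=.
  rewrite (tree_eqb_code _ _ code_nat_inj); case: ifP => // _.
  rewrite -[Node _ Leaf]/(code_opt (Some a)) (tree_eqb_code _ _ (@code_opt_inj B)).
  by case: ifP.
have -> : tree_eqb (code_opt t.1.2) Leaf = (t.1.2 == None).
  exact: (tree_eqb_code _ None (@code_opt_inj B)).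
by case: ifP.
Qed.

(* There are as many rounds as configurations, so the result is closed under silent
   moves. *)
Definition close (init : seq nat) (T : seq transition) (S : seq conf) : seq conf :=
  foldl (fun acc _ => foldl (fun acc _ => pass None T acc acc)
    (foldl (fun acc _ => pass None T acc acc) acc init) T) S (enum P).

Definition close_step (t2 : tree) : tree :=
  pass_tree (Node (get_acc t2) (Node Leaf (Node (get_acc t2) (tree_tl (tree_tl (tree_hd (tree_hd t2))))))).

Definition round_step (t1 : tree) : tree :=
  tree_fold close_step t1
    (tree_fold close_step t1 (get_acc t1) (tree_hd (tree_tl (tree_hd t1))))
    (tree_tl (tree_tl (tree_tl (tree_hd t1)))).

Definition close_tree (u : tree) : tree :=
  tree_fold round_step u (tree_hd u) (code_seq (@code_fin P) (enum P)).

Lemma computable_close : computable close_tree.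
Proof.
have c2 : computable close_step.
  by rewrite /close_step /get_acc; apply: computable_comp computable_pass; computability.
have c1 : computable round_step by rewrite /round_step /get_acc; computability.
by rewrite /close_tree; computability.
Qed.

Lemma close_tree_code init T S :
  close_tree (Node (code_seq code_conf S) (Node (code_seq code_nat init) (code_exts T))) =
  code_seq code_conf (close init T S).
Proof.
rewrite /close_tree [tree_hd _]/=; apply: (tree_fold_code (cy := code_seq code_conf)) => acc p.
rewrite /round_step /get_acc [tree_hd _]/= [X in tree_fold _ _ X _]/= [X in tree_fold _ _ _ X]/=.
have st C Y (X : Type) (cx : X -> tree) acc1 x :
    close_step (Node (Node (Node C (Node (code_seq code_nat init) (code_exts T))) Y)
      (Node (code_seq code_conf acc1) (cx x))) =
    code_seq code_conf (pass None T acc1 acc1).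
  exact: (@pass_tree_code None).
by rewrite !(tree_fold_code (cy := code_seq code_conf) (g := fun acc _ => pass None T acc acc)).
Qed.

Definition start (P0 : seq P) (init : seq nat) : seq conf :=
  foldl (fun acc n => foldl (fun acc p => (p, n) :: acc) acc P0) [::] init.

Definition search P0 init T (w : seq B) : seq conf :=
  foldl (fun S a => close init T (pass (Some a) T [::] S)) (close init T (start P0 init)) w.

Definition search_accepts (P0 PF : seq P) (i : nfa B * word B) : bool :=
  foldl (fun b e => foldl (fun b n => foldl (fun b p => if e == (p, n) then true else b) b PF)
    b (nfa_final i.1)) false (search P0 (nfa_init i.1) (nfa_trans i.1) i.2).

Section SearchTree.
Variables P0 PF : seq P.

Let in_init u := tree_hd (tree_hd u).
Let in_final u := tree_hd (tree_tl (tree_hd u)).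
Let in_trans u := tree_tl (tree_tl (tree_hd u)).

Definition start_inner (t : tree) : tree :=
  Node (Node (get_item t) (get_item (tree_hd t))) (get_acc t).
Definition start_outer (t : tree) : tree :=
  tree_fold start_inner t (get_acc t) (code_seq (@code_fin P) P0).
Definition start_tree (u : tree) : tree := tree_fold start_outer u Leaf (in_init u).

Definition close_in u S := close_tree (Node S (Node (in_init u) (Node Leaf (in_trans u)))).
Definition letter_step (t : tree) : tree :=
  close_in (tree_hd t) (pass_tree (Node Leaf (Node (Node (get_item t) Leaf)
    (Node (get_acc t) (Node Leaf (in_trans (tree_hd t))))))).
Definition search_tree (u : tree) : tree :=
  tree_fold letter_step u (close_in u (start_tree u)) (tree_tl u).

Definition final_inner (t : tree) : tree :=
  if tree_eqb (get_item (tree_hd (tree_hd t))) (Node (get_item t) (get_item (tree_hd t)))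
  then Node Leaf Leaf else get_acc t.
Definition final_middle (t : tree) : tree :=
  tree_fold final_inner t (get_acc t) (code_seq (@code_fin P) PF).
Definition final_outer (t : tree) : tree :=
  tree_fold final_middle t (get_acc t) (in_final (tree_hd t)).
Definition accepts_tree (u : tree) : tree := tree_fold final_outer u Leaf (search_tree u).

Lemma computable_accepts : computable accepts_tree.
Proof.
have s1 : computable start_inner by rewrite /start_inner /get_item /get_acc; computability.
have s2 : computable start_outer by rewrite /start_outer /get_acc; computability.
have s3 : computable start_tree by rewrite /start_tree /in_init; computability.
have cl f g : computable f -> computable g -> computable (fun t => close_in (f t) (g t)).
  move=> cf cg; rewrite /close_in /in_init /in_trans.
  by apply: computable_comp computable_close; computability.
have l1 : computable letter_step.
  rewrite /letter_step /get_item /get_acc /in_trans; apply: cl; first by computability.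
  by apply: computable_comp computable_pass; computability.
have l2 : computable search_tree.
  rewrite /search_tree; apply: computable_fold => //; last by computability.
  by apply: cl => //; computability.
have f1 : computable final_inner by rewrite /final_inner /get_item /get_acc; computability.
have f2 : computable final_middle by rewrite /final_middle /get_acc; computability.
have f3 : computable final_outer by rewrite /final_outer /get_acc /in_final; computability.
by rewrite /accepts_tree; computability.
Qed.

Lemma accepts_tree_code i : accepts_tree (code_instance i) = tree_of_bool (search_accepts P0 PF i).
Proof.
case: i => [[init final T] w].
have clE S : close_in (code_instance (Nfa init final T, w)) (code_seq code_conf S) =
    code_seq code_conf (close init T S) by exact: close_tree_code.
have -> : accepts_tree (code_instance (Nfa init final T, w)) =
    tree_fold final_outer (code_instance (Nfa init final T, w)) (tree_of_bool false)
      (code_seq code_conf (search P0 init T w)).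
  rewrite /accepts_tree; congr (tree_fold _ _ _ _).
  rewrite /search_tree (_ : start_tree _ = code_seq code_conf (start P0 init)).
    rewrite clE; apply: (tree_fold_code (cy := code_seq code_conf)) => S a.
    rewrite /letter_step -clE; congr (close_in _ _).
    exact: (@pass_tree_code (Some a) T [::] S).
  apply: (@tree_fold_code _ _ code_nat (code_seq code_conf) start_outer _
    (fun acc n => foldl (fun acc p => (p, n) :: acc) acc P0) [::] init) => acc n.
  exact: (@tree_fold_code _ _ (@code_fin P) (code_seq code_conf) start_inner _
    (fun acc p => (p, n) :: acc)).
apply: (tree_fold_code (cy := tree_of_bool)) => b e.
rewrite /final_outer /get_acc /in_final [tree_hd _]/= [X in tree_fold _ _ _ X]/=.
apply: (tree_fold_code (cy := tree_of_bool)) => b1 n.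
rewrite /final_middle /get_acc [tree_hd _]/=.
apply: (tree_fold_code (cy := tree_of_bool)) => b2 p.
have eqE : tree_eqb (code_conf e) (code_conf (p, n)) = (e == (p, n)).
  exact: tree_eqb_code code_conf_inj.
rewrite /final_inner /get_item /get_acc.
rewrite [LHS](_ : _ = if tree_eqb (code_conf e) (code_conf (p, n))
  then Node Leaf Leaf else tree_of_bool b2) // eqE.
by case: ifP.
Qed.

End SearchTree.
End Configurations.

(** As long as the list is not closed, every round adds a new element of [U], so [size U] rounds
    suffice. Compatibility of [f] with [=i] lets lists be compared as sets, despite repetitions. *)
Lemma saturate (T : eqType) (U : seq T) (f : seq T -> seq T) (S : seq T) :
  (forall X, {subset X <= f X}) ->
  (forall X, {subset X <= U} -> {subset f X <= U}) ->
  (forall X Y, X =i Y -> f X =i f Y) -> {subset S <= U} ->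
  let X := iter (size U) f S in {subset f X <= X}.
Proof.
move=> f_ext f_U f_eq SU /=; pose X j := iter j f S.
have XU j : {subset X j <= U} by elim: j => //= j; exact: f_U.
have grow j : {subset f (X j) <= X j} \/ j <= size (undup (X j)).
  elim: j => [|j [cl|sz]]; [by right| |].
    left; have e : f (X j) =i X j by move=> x; apply/idP/idP => [/cl|/f_ext].
    by move=> x; rewrite /= (f_eq _ _ e).
  have sub : {subset undup (X j) <= undup (X j.+1)}.
    by move=> x; rewrite !mem_undup; exact: f_ext.
  have [le|lt] := leqP (size (undup (X j.+1))) (size (undup (X j))).
    have [_ e] := uniq_min_size (undup_uniq _) sub le.
    have e' : f (X j) =i X j by move=> x; move: (e x); rewrite !mem_undup.
    by left => x; rewrite /= (f_eq _ _ e').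
  by right; exact: leq_ltn_trans sz lt.
have [//|sz] := grow (size U).
have sub : {subset undup (X (size U)) <= U} by move=> x; rewrite mem_undup; exact: XU.
have [_ e] := uniq_min_size (undup_uniq _) sub sz.
by move=> x xf; rewrite -mem_undup e; exact: f_U (XU _) x xf.
Qed.

Lemma foldl_const (X Y : Type) (f : Y -> Y) y (s : seq X) :
  foldl (fun a _ => f a) y s = iter (size s) f y.
Proof. by elim: s y => //= x s IH y; rewrite IH -iterSr. Qed.

(** * Correctness of the search *)

Section SearchCorrect.
Variables (P B : finType) (D : seq (P * option B * option B * P)).
Variable d : P -> option B -> option B -> P -> Prop.
Hypothesis DE : forall t, t \in D <-> d t.1.1.1 t.1.1.2 t.1.2 t.2.
Variables (init : seq nat) (T : seq (nat * B * nat)).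

(** The NFA as a transducer without output; its product with the given transducer is an instance of
    [comp_step], so the composition lemmas apply to the search. *)
Definition nfa_step (n : nat) (b : option B) (_ : option void) (n' : nat) : Prop :=
  exists2 a, b = Some a & (n, a, n') \in T.

Let mu := comp_step d nfa_step.

Lemma mem_passE b acc S e' : e' \in pass D b T acc S <->
  e' \in acc \/ exists2 e, e \in S & mu e b None e'.
Proof.
rewrite mem_pass; split=> -[|h]; try by left.
  case: h => [[[[p b'] c] q] /DE /= dt [[p' n] eS [x xT mv]]]; right; exists (p', n) => //.
  move: xT mv; rewrite /move /= inE => xT.
  case: eqP => // ep; case: eqP => // eb; subst p' b'.
  case: x xT => [[[n1 a] n2]|] /= xT.
    case: eqP => // en; case: eqP => // ec [<-]; subst n1 c.
    apply: Or33; exists a; split=> //; exists a => //=.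
    by move: xT; rewrite mem_map // => ? ? [].
  by case: eqP => // ec [<-]; subst c; apply: Or31.
right; case: h => [[p n] eS []]; case: e' => [q n'] /=.
- move=> [dp -> _]; exists (p, b, None, q); first exact/DE.
  by exists (p, n) => //; exists None; rewrite /move /= ?eqxx ?mem_head.
- by move=> [[]].
- move=> [c [dp [a [<-] nT]]]; exists (p, b, Some c, q); first exact/DE.
  exists (p, n) => //; exists (Some (n, c, n')); last by rewrite /move /= !eqxx.
  by rewrite inE /= map_f.
Qed.

Let U : seq (P * nat) := [seq (p, n) | p <- enum P, n <- init ++ [seq t.2 | t <- T]].

Lemma closeE S : close D init T S = iter (size U) (fun X => pass D None T X X) S.
Proof.
rewrite /close size_allpairs size_cat size_map.
elim: (enum P) S => //= p s IH S; rewrite IH !foldl_const -!iterD; congr iter.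
by rewrite mulSn; lia.
Qed.

Lemma mem_U p n : (p, n) \in U = (n \in init ++ [seq t.2 | t <- T]).
Proof.
apply/allpairsP/idP => [[[p' n'] [_ h [_ ->]]] //|h].
by exists (p, n); rewrite mem_enum.
Qed.

Lemma mu_U e b e' : e \in U -> mu e b None e' -> e' \in U.
Proof.
case: e e' => [p n] [p' n']; rewrite !mem_U => nU [] /=.
- by move=> [_ -> _].
- by move=> [[]].
- by move=> [c [_ [a _ h]]]; rewrite mem_cat; apply/orP; right; apply/mapP; exists (n, a, n').
Qed.

Lemma mem_close S e' : {subset S <= U} ->
  (e' \in close D init T S <-> exists2 e, e \in S & run mu e [::] [::] e') /\
  {subset close D init T S <= U}.
Proof.
move=> SU; rewrite closeE; pose f X := pass D None T X X.
have f_ext X : {subset X <= f X} by move=> x xX; apply/mem_passE; left.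
have f_U X : {subset X <= U} -> {subset f X <= U}.
  by move=> XU x /mem_passE[/XU //|[e /XU]]; exact: mu_U.
have f_eq X Y : X =i Y -> f X =i f Y.
  move=> XY x; apply/idP/idP => /mem_passE[h|[e h1 h2]]; apply/mem_passE.
  - by left; rewrite -XY.
  - by right; exists e; rewrite -?XY.
  - by left; rewrite XY.
  - by right; exists e; rewrite ?XY.
have cl := saturate f_ext f_U f_eq SU.
split; last by elim: (size U) => //= j; exact: f_U.
split=> [|[e eS]].
  elim: (size U) e' => [|j IH] e' /=; first by exists e' => //; exact: run_nil.
  move=> /mem_passE[/IH //|[e1 /IH[e eS r1] st]]; exists e => //.
  by apply: run_cat r1 (run1 st : run mu e1 [::] [::] e').
move=> rn; have eX : e \in iter (size U) f S by elim: (size U) => //= j; exact: f_ext.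
have main q x y q' : run mu q x y q' -> x = [::] ->
    q \in iter (size U) f S -> q' \in iter (size U) f S.
  elim=> [//|q0 [//|] [[]//|] q1 {}x {}y q2 st _ IH /IH h qX].
  by apply: h; apply: cl; apply/mem_passE; right; exists q0.
exact: main rn erefl eX.
Qed.

Variables P0 PF : seq P.

Lemma mem_start e : e \in start P0 init <-> e.1 \in P0 /\ e.2 \in init.
Proof.
rewrite (@mem_foldl _ _ _ (fun n e => exists2 p, p \in P0 & e = (p, n))); last first.
  move=> acc n e'; apply: (@mem_foldl _ _ _ (fun p e => e = (p, n))) => {}acc p {}e'.
  by rewrite inE; split=> [/predU1P|[->|->]]; [tauto|rewrite orbT|rewrite eqxx].
split=> [[//|[n ni [p pP ->]]] //|[h1 h2]]; right.
by exists e.2 => //; exists e.1 => //; case: e {h1 h2}.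
Qed.

Lemma mem_search w e : e \in search D P0 init T w <->
  exists2 e0, e0.1 \in P0 /\ e0.2 \in init & run mu e0 w [::] e.
Proof.
suff [] : (forall e, e \in search D P0 init T w <->
    exists2 e0, e0.1 \in P0 /\ e0.2 \in init & run mu e0 w [::] e) /\
  {subset search D P0 init T w <= U} by [].
have startU : {subset start P0 init <= U}.
  by move=> [p n] /mem_start[_ h]; rewrite mem_U mem_cat h.
elim/last_ind: w {e} => [|w a [IH IHU]].
  split=> [e|e]; last by case: (mem_close e startU) => _; apply.
  case: (mem_close e startU) => -> _.
  by split=> -[e0 /mem_start h r]; exists e0 => //; exact/mem_start.
have passU : {subset pass D (Some a) T [::] (search D P0 init T w) <= U}.
  by move=> e /mem_passE[//|[e1 /IHU]]; exact: mu_U.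
rewrite /search foldl_rcons -/(search D P0 init T w).
split=> [e|e]; last by case: (mem_close e passU) => _; apply.
case: (mem_close e passU) => -> _; split.
  move=> [e2 /mem_passE[//|[e1 /IH[e0 h r1] st]] r2]; exists e0 => //.
  rewrite -cats1 -[[::]]/([::] ++ [::]); apply: run_cat r1 _.
  by have := run_step st r2.
move=> [e0 h]; rewrite -cats1 => rn.
have [e1 [y1 [y2 [r1 r2 _]]]] := run_split_in rn.
have [q1 [q2 [z1 [c [z2 [r3 st r4 _]]]]]] := run_cons_in r2.
exists q2; last by rewrite (seq_void z2) in r4.
apply/mem_passE; right; exists q1; last by case: c st => // -[].
apply/IH; exists e0 => //; rewrite -[w]cats0 -[[::]]/([::] ++ [::]).
by rewrite (seq_void y1) in r1; rewrite (seq_void z1) in r3; exact: run_cat r1 r3.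
Qed.

End SearchCorrect.

Lemma nfa_accepts_run (B : finType) (N : nfa B) n v : nfa_accepts_from N n v <->
  exists2 n', n' \in nfa_final N & run (nfa_step (nfa_trans N)) n v [::] n'.
Proof.
elim: v n => [|a v IH] n /=.
  split=> [h|[n' h]]; first by exists n => //; exact: run_nil.
  by move ev : [::] => v rn; case: rn ev h => // q b c q' x y q'' [a -> _].
split=> [/hasP[[[m a'] n1] tT /andP[/= /eqP[em ea] /IH[n' h r]]]|[n' h rn]].
  subst m a'.
  exists n' => //; rewrite -[a :: v]/(seq_of_opt (Some a) ++ v) -[[::]]/(seq_of_opt None ++ [::]).
  by apply: run_step r; exists a.
have [q1 [q2 [z1 [c [z2 [r3 [a' [<-] tT] r4 _]]]]]] := run_cons_in rn.
have e1 : q1 = n.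
  move: r3; move ev : [::] => u r3; case: r3 ev => // q b c' q' x y q'' [a'' -> _] //.
apply/hasP; exists (q1, a, q2) => //; rewrite e1 eqxx /=; apply/IH; exists n' => //.
by rewrite (seq_void z2) in r4.
Qed.

Section Decidability.
Variables (B : finType) (M : monoidType) (sigma : word B -> M) (beta : word B -> word B).
Hypothesis sigma_morph : surjective_morphism sigma.
Hypothesis beta_transduction : transduction (fun u v => v = beta u).
Hypothesis sigma_beta : forall w, sigma (beta w) = sigma w.
Hypothesis beta_sigma : forall u v, sigma u = sigma v -> beta u = beta v.

(** The transducer for the kernel of [sigma] reads [w] and feeds its output to the NFA, so
    membership means that a final configuration is reachable. The transducer is a constant inside
    the program; only the NFA and [w] are input. *)
Lemma rational_decidable : decidable_rational_subset_membership M.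
Proof.
exists B, sigma; split=> //.
have [P [d [i [f H]]]] := same_image_transduction beta_transduction sigma_beta beta_sigma.
pose D := [seq t <- enum {: P * option B * option B * P} | `[< d t.1.1.1 t.1.1.2 t.1.2 t.2 >]].
have DE t : t \in D <-> d t.1.1.1 t.1.1.2 t.1.2 t.2.
  by rewrite mem_filter mem_enum andbT; split=> /asboolP.
pose P0 := [seq p <- enum P | `[< i p >]]; pose PF := [seq p <- enum P | `[< f p >]].
have [c [m [m0 comp]]] := computable_accepts D P0 PF.
exists c => -[N w]; have [s [ex v _]] := comp (input_store (code_instance (N, w))).
exists s => //; rewrite v accepts_tree_code; congr tree_of_bool.
have orP_fold (X : eqType) (g : bool -> X -> bool) (R : X -> Prop) b s0 :
    (forall b x, g b x <-> b \/ R x) -> foldl g b s0 <-> b \/ exists2 x, x \in s0 & R x.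
  move=> h; elim: s0 b => [|x s0 IH] b /=; first by split=> [|[//|[]//]]; left.
  rewrite IH h; split=> [[[|r]|[z zs r]]|[|[z]]].
  - by left.
  - by right; exists x; rewrite ?mem_head.
  - by right; exists z => //; rewrite inE zs orbT.
  - by left; left.
  - by rewrite inE => /predU1P[->|zs] r; [left; right|right; exists z].
have accE : search_accepts D P0 PF (N, w) <-> exists2 e,
    e \in search D P0 (nfa_init N) (nfa_trans N) w & e.1 \in PF /\ e.2 \in nfa_final N.
  rewrite /search_accepts (@orP_fold _ _ (fun e => exists2 n, n \in nfa_final N & exists2 p,
    p \in PF & e = (p, n))); last first.
    move=> b e; apply: (@orP_fold _ _ (fun n => exists2 p, p \in PF & e = (p, n))) => {}b n.
    apply: (@orP_fold _ _ (fun p => e = (p, n))) => {}b p.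
    by case: eqP => [->|ne]; [split=> // _; right|split=> [|[]//]; left].
  split=> [[//|[e es [n nF [p pF ee]]]]|[e es [pF nF]]]; first by exists e => //; rewrite ee.
  right; exists e => //; exists e.2 => //; exists e.1 => //.
  exact: surjective_pairing.
apply/idP/asboolP => /=.
  move=> /accE[[p n] /(mem_search DE) [[p0 n0] /= [p0P n0I] rn] [/= pF nF]].
  have [v0 [/= r1 r2]] := run_comp_sound rn.
  exists v0; last first.
    apply/esym/H; exists p0, p; split=> //.
      by move: p0P; rewrite mem_filter => /andP[/asboolP].
    by move: pF; rewrite mem_filter => /andP[/asboolP].
  by apply/hasP; exists n0 => //; apply/nfa_accepts_run; exists n.
move=> [v0 /hasP[n0 n0I /nfa_accepts_run[n nF r2]] /esym/H[p0 [p [ip fp r1]]]].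
apply/accE; exists (p, n); last by rewrite mem_filter mem_enum andbT; split=> //; exact/asboolP.
apply/(mem_search DE); exists (p0, n0); last exact: run_comp_complete r1 r2.
by rewrite mem_filter mem_enum andbT; split=> //; exact/asboolP.
Qed.

End Decidability.

(** * Finite-state computation of the normal form *)

Section NormalTransducer.
Variables (A J : finType) (r : J * bool -> seq A) (l : nat).
Local Notation I := (J * bool)%type.
Local Notation mode := (mode J).
Implicit Types (i : I) (z : seq A) (m : mode).
Hypothesis l_gt0 : 0 < l.
Hypothesis r_long : forall i, 4 * l <= size (r i).

Let K := l + \max_(i : I) size (r i).

Lemma size_r_le i : l + size (r i) <= K.
Proof. by rewrite leq_add2l (bigmax_sup i). Qed.

Definition info_type : Type := ({bseq K of A} * {ffun I * 'I_K.+1 -> bool})%type.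
HB.instance Definition _ := Finite.on info_type.

(* [K] bounds the look-ahead needed by [step] and [live]. *)
Definition info z : info_type :=
  (insub_bseq K (take K z), [ffun x : I * 'I_K.+1 => `[< live r l x.1 (drop x.2 z) >]]).

(** Offset 0 is left out because liveness there is derived, through [liveE], from the letters and
    the later offsets. *)
Definition agree z z' : Prop := take K z = take K z' /\
  forall i n, 0 < n <= K -> `[< live r l i (drop n z) >] = `[< live r l i (drop n z') >].

Lemma info_take z z' : info z = info z' -> take K z = take K z'.
Proof.
have sz u : size (take K u) <= K by rewrite size_take; case: ltnP => // /ltnW.
by case=> /(congr1 val) e _; move: e; rewrite !val_insubd !sz.
Qed.

Lemma info_live z z' i n : info z = info z' -> n <= K ->
  `[< live r l i (drop n z) >] = `[< live r l i (drop n z') >].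
Proof.
case=> _ /ffunP e nK; have := e (i, Ordinal (nK : n < K.+1)).
by rewrite !ffunE.
Qed.

Lemma info_agree_cons a z z' : info z = info z' -> agree (a :: z) (a :: z').
Proof.
move=> e; split=> [|i [//|n] /andP[_ nK]]; last exact: (info_live i e (ltnW _)).
have := info_take e; have : 0 < K by rewrite /K addn_gt0 l_gt0.
case: K => //= k _ e'; congr (_ :: _).
by have := congr1 (take k) e'; rewrite !take_takel.
Qed.

Lemma agree_prefix z z' (f : seq A) n : agree z z' -> n + size f <= K ->
  prefix f (drop n z) = prefix f (drop n z').
Proof.
move=> [e _] le; rewrite !prefixE !take_drop.
have aux u : take (size f + n) u = take (size f + n) (take K u) by rewrite take_takel //; lia.
by rewrite aux e -aux.
Qed.

Lemma agree_takel z z' n : agree z z' -> n <= K -> take n z = take n z'.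
Proof. by move=> [e _] nK; rewrite -(take_takel z nK) e take_takel. Qed.

Lemma agree_matches o z z' : agree z z' -> @matches A J r l o z =1 @matches A J r l o z'.
Proof.
move=> ag x; rewrite /matches.
have g := size_minus_gt l_gt0 r_long x.1; have lx := ltn_ord x.2.
have sK := size_r_le x.1; have sm := size_minus r l x.1.
rewrite -{1}(drop0 z) -{1}(drop0 z') (agree_prefix ag); last by rewrite size_drop; lia.
by case: ag => _ ->; last by lia.
Qed.

Lemma agree_completes i z z' : agree z z' -> @completes A J r l i z =1 @completes A J r l i z'.
Proof.
move=> ag x; rewrite /completes.
have g := size_minus_gt l_gt0 r_long x.1; have lx := ltn_ord x.2.
have sK := size_r_le x.1; have sm := size_minus r l x.1.
rewrite (agree_prefix ag); last by lia.
rewrite (agree_takel (n := x.2) ag); last by lia.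
by case: ag => _ ->; last by lia.
Qed.

Lemma agree_suf i z z' : agree z z' -> prefix (suf r l i) z = prefix (suf r l i) z'.
Proof.
move=> ag; rewrite -(drop0 z) -(drop0 z') (agree_prefix ag) //.
by rewrite size_suf //; have := size_r_le i; lia.
Qed.

Lemma agree_step m z z' : agree z z' -> step r l m z = step r l m z'.
Proof.
move=> ag; have t1 : take 1 z = take 1 z'.
  by apply: (agree_takel ag); rewrite addn_gt0 l_gt0.
case: m => [o|i] /=; first by rewrite (eq_pick (agree_matches o ag)) t1.
by rewrite (agree_suf i ag) (eq_pick (agree_completes i ag)) t1.
Qed.

Lemma liveE i z : live r l i z <-> prefix (suf r l i) z \/ exists x, @completes A J r l i z x.
Proof.
split=> [|[/prefix_live //|[x /and3P[p1 p2 /asboolP lv]]]].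
  case=> [y|h i' y hl p lv]; first by left; exact: prefix_prefix.
  by right; have [x cx _] := completesP hl p lv; exists x.
have xl := ltn_ord x.2; have g := size_minus_gt l_gt0 r_long x.1.
have := size_prefix p1; rewrite size_drop /= => sz.
have [y e] := prefixP p1.
have ez : z = take x.2 z ++ minus r l x.1 ++ y by rewrite -e cat_take_drop.
rewrite ez; apply: live_next p2 _; first by rewrite size_takel //; lia.
move: lv; rewrite {1}ez addnC -drop_drop drop_size_cat; last by rewrite size_takel //; lia.
by rewrite drop_size_cat.
Qed.

(** So the look-ahead is computed by a finite automaton reading from right to left, which is what
    makes a guess of it checkable. *)
Lemma info_cons a z z' : info z = info z' -> info (a :: z) = info (a :: z').
Proof.
move=> e; have ag := info_agree_cons a e.
congr (_, _); first by congr insub_bseq; case: ag.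
apply/ffunP => -[i [[|n] nK]]; rewrite !ffunE /=; last exact: (info_live i e (ltnW _)).
apply/asbool_equiv_eq; rewrite !liveE (agree_suf i ag).
by split=> -[p|[x cx]]; [left|right; exists x|left|right; exists x];
  rewrite // ?(agree_completes i ag) // -(agree_completes i ag).
Qed.

(** Keeps the output buffer and the skip counter of the transducer within a finite state set. *)
Lemma step_bound m z : (size (step r l m z).1.1 <= K) /\ (step r l m z).1.2 <= K.
Proof.
have K0 : 0 < K by rewrite addn_gt0 l_gt0.
have t1 : size (take 1 z) <= K by rewrite size_take; case: ltnP => // ?; lia.
have lK : l <= K by exact: leq_addr.
have se i n : size (emit r i n) <= K.
  by rewrite size_drop; have := size_r_le (canon_index r i n); lia.
have sk i n : n <= l -> (n + size (minus r l i)).-1 <= K.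
  by move=> nl; rewrite size_minus; have := size_r_le i; lia.
case: m => [o|i] /=.
  case: pickP => [x _|_] /=; split=> //.
  by have := sk x.1 0 isT; have := size_r_le x.1; rewrite size_minus; lia.
case: ifP => _ /=; first by split=> //; lia.
by case: pickP => [x _|_] /=; split=> //; apply: sk; exact: ltnW.
Qed.

Lemma normal_transduction :
  transduction (fun u v => v = normal r l 0 (inl None) u).
Proof.
pose Q : finType := ('I_K.+1 * mode * info_type * {bseq K of A})%type.
pose skip (p : Q) : nat := p.1.1.1; pose md (p : Q) : mode := p.1.1.2.
pose seen (p : Q) : info_type := p.1.2; pose buf (p : Q) : seq A := p.2.
(* The transducer guesses the look-ahead and checks it while reading on. *)
pose d (p : Q) (b c : option A) (q : Q) :=
  if buf p is c0 :: w0 then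
    [/\ b = None, c = Some c0 & [/\ skip q = skip p, md q = md p, seen q = seen p & buf q = w0]]
  else exists a z, [/\ b = Some a, c = None, seen p = info (a :: z) /\ seen q = info z &
    if skip p is n.+1 then [/\ skip q = n, md q = md p & buf q = [::]]
    else (buf q, skip q, md q) = step r l (md p) (a :: z)].
(* Correctness of the guesses propagates backwards from the last state, which must carry the
   look-ahead of the empty word. *)
pose final (p : Q) := seen p = info [::] /\ buf p = [::].
have sound p x y q : run d p x y q -> final q ->
    seen p = info x /\ y = buf p ++ normal r l (skip p) (md p) x.
  elim=> [{}p [-> ->]|{}p b c p1 {}x {}y {}q + _ IHr fq] //; have [es ey] := IHr fq.
  rewrite /d; case: (buf p) => [|c0 w0]; last first.
    by move=> [-> -> [en em e eb]]; rewrite -e es ey /= en em eb.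
  move=> [a [z [-> -> [e1 e2]]]] /=; rewrite es in e2.
  rewrite e1 (info_cons a e2); split=> //; move: p0; rewrite ey.
  case: (skip p) => [|n]; last by move=> [-> -> ->].
  by rewrite (agree_step (md p) (info_agree_cons a e2)) => <-.
have mk n m e (w : seq A) : n <= K -> size w <= K ->
    exists p : Q, [/\ skip p = n, md p = m, seen p = e & buf p = w].
  by move=> nK wK; exists (inord n, m, e, Bseq wK); split=> //; rewrite /skip /= inordK.
have complete n m x (w : seq A) : n <= K -> size w <= K -> forall p : Q,
    [/\ skip p = n, md p = m, seen p = info x & buf p = w] ->
    exists2 q, final q & run d p x (w ++ normal r l n m x) q.
  move=> nK wK p; elim: x n m w nK wK p => [|a x IHx] n m w nK wK; elim: w wK => [|c w IHw] wK p [e1 e2 e3 e4].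
  - by exists p; [|exact: run_nil].
  - have wK' := ltnW wK; have [p1 [h1 h2 h3 h4]] := mk n m (info [::]) w nK wK'.
    have [q fq rn] := IHw wK' p1 (And4 h1 h2 h3 h4); exists q => //.
    have st : d p None (Some c) p1 by rewrite /d e4 h1 h2 h3 h4.
    exact: (run_step st rn).
  - case: n nK e1 => [|n] nK e1.
      have [b1 b2] := step_bound m (a :: x).
      have [p1 [h1 h2 h3 h4]] := mk _ (step r l m (a :: x)).2 (info x) _ b2 b1.
      have [q fq rn] := IHx _ _ _ b2 b1 p1 (And4 h1 h2 h3 h4); exists q => //.
      have st : d p (Some a) None p1.
        rewrite /d e4; exists a, x; split=> //; rewrite e1 e2 h4 h1 h2.
        by case: step => -[].
      exact: (run_step st rn).
    have nK' := ltnW nK; have [p1 [h1 h2 h3 h4]] := mk n m (info x) [::] nK' (leq0n _).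
    have [q fq rn] := IHx n m [::] nK' (leq0n K) p1 (And4 h1 h2 h3 h4); exists q => //.
    have st : d p (Some a) None p1.
      by rewrite /d e4; exists a, x; split=> //; rewrite e1; split; rewrite ?h2.
    exact: (run_step st rn).
  - have wK' := ltnW wK; have [p1 [h1 h2 h3 h4]] := mk n m (info (a :: x)) w nK wK'.
    have [q fq rn] := IHw wK' p1 (And4 h1 h2 h3 h4); exists q => //.
    have st : d p None (Some c) p1 by rewrite /d e4 h1 h2 h3 h4.
    exact: (run_step st rn).
exists Q, d, (fun p => [/\ skip p = 0, md p = inl None & buf p = [::]]), final => x y.
split=> [->|[p [q [[e1 e2 e3] fq /sound[//|_ ->]]]]]; last by rewrite e1 e2 e3.
have [p [h1 h2 h3 h4]] := mk 0 (inl None) (info x) [::] (leq0n _) (leq0n _).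
have [q fq rn] := complete 0 (inl None) x [::] (leq0n _) (leq0n _) p (And4 h1 h2 h3 h4).
by exists p, q; split.
Qed.
End NormalTransducer.

(** * Generic presentations *)

Section RelationWords.
Variables (A : finType) (k : nat).
Local Notation I := ('I_k * bool)%type.
Implicit Types (p q : presentation A k) (i : I).

Definition rel_word p i : seq A :=
  if i.2 then (tnth p i.1).2 else (tnth p i.1).1.

Definition set_word p i (w : seq A) : presentation A k :=
  [tuple if j == i.1 then
    (if i.2 then ((tnth p j).1, w : word A) else (w : word A, (tnth p j).2)) else tnth p j | j < k].

Lemma rel_word_set p i w i' :
  rel_word (set_word p i w) i' = if i' == i then w else rel_word p i'.
Proof.
rewrite /rel_word /set_word tnth_mktuple; case: i i' => [j b] [j' b'] /=.
by rewrite xpair_eqE; case: eqP => [->|_]; case: b b' => [] [].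
Qed.

Lemma rel_word_inj p q : rel_word p =1 rel_word q -> p = q.
Proof.
move=> e; apply: eq_from_tnth => j.
have := e (j, true); have := e (j, false); rewrite /rel_word /=.
by case: (tnth p j) (tnth q j) => [u v] [u' v'] /= -> ->.
Qed.

Lemma sum_lengthE p : sum_length p = \sum_(i : I) size (rel_word p i).
Proof.
rewrite /sum_length big_tnth (eq_bigr _ (fun i _ => erefl)).
rewrite -(pair_bigA _ (fun j b => size (rel_word p (j, b)))) /=.
rewrite (reindex (cast_ord (esym (size_tuple p)))) /=; last first.
  by exists (cast_ord (size_tuple p)) => x _; rewrite ?cast_ordK ?cast_ordKV.
apply: eq_bigr => j _; rewrite big_bool /rel_word /= addnC.
by rewrite !(tnth_nth ([::], [::])).
Qed.

Lemma max_lengthE p : max_length p = \max_(i : I) size (rel_word p i).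
Proof.
rewrite /max_length big_tnth.
rewrite -(pair_bigA _ (fun j b => size (rel_word p (j, b)))) /=.
rewrite (reindex (cast_ord (esym (size_tuple p)))) /=; last first.
  by exists (cast_ord (size_tuple p)) => x _; rewrite ?cast_ordK ?cast_ordKV.
apply: eq_bigr => j _; rewrite big_bool /rel_word /= maxnC.
by rewrite !(tnth_nth ([::], [::])).
Qed.

Lemma max_attained p : 0 < k -> exists i, size (rel_word p i) = max_length p.
Proof.
move=> k0; have I0 : 0 < #|{: I}| by rewrite card_prod card_ord card_bool; lia.
have [i0 e] := eq_bigmax (fun i => size (rel_word p i)) I0.
by exists i0; rewrite max_lengthE e.
Qed.

End RelationWords.

(** [V] is the choice made in modifying a presentation, [W] the information recorded in order to
    undo the modification. *)
Lemma count_inj (T : choiceType) (X Y : set T) (V W : finType) (f : T -> V -> W * T) :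
  finite_set X -> finite_set Y ->
  (forall x v, X x -> Y (f x v).2) ->
  (forall x x' v v', X x -> X x' -> f x v = f x' v' -> x = x' /\ v = v') ->
  #|` fset_set X| * #|V| <= #|W| * #|` fset_set Y|.
Proof.
move=> fX fY fXY f_inj.
rewrite !cardfE -!card_prod.
have inX (x : fset_set X) : X (val x) by have := valP x; rewrite in_fset_set // inE.
have inY (xv : fset_set X * V) : (f (val xv.1) xv.2).2 \in fset_set Y.
  by rewrite in_fset_set // inE; apply: fXY.
apply: (@leq_card _ _ (fun xv : fset_set X * V =>
  ((f (val xv.1) xv.2).1, [` inY xv]%fset) : W * fset_set Y)).
move=> [x v] [x' v'] /= [e1 e2].
have [] := f_inj (val x) (val x') v v' (inX x) (inX x').
  by rewrite [LHS]surjective_pairing [RHS]surjective_pairing e1 e2.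
by move=> /val_inj -> ->.
Qed.

Definition overwrite (T : Type) (w : seq T) a (t : seq T) : seq T :=
  take a w ++ t ++ drop (a + size t) w.

Lemma size_overwrite (T : Type) (w t : seq T) a :
  a + size t <= size w -> size (overwrite w a t) = size w.
Proof.
by move=> h; rewrite !size_cat size_takel ?size_drop; lia.
Qed.

Lemma overwriteK (T : Type) (w t : seq T) a l : size t = l -> a + l <= size w ->
  take l (drop a (overwrite w a t)) = t.
Proof.
by move=> <- h; rewrite drop_size_cat ?take_size_cat // size_takel //; lia.
Qed.

Lemma overwrite_nth (T : eqType) (w w' t : seq T) x0 a n :
  a + size t <= size w -> a + size t <= size w' ->
  overwrite w a t = overwrite w' a t -> n < a \/ a + size t <= n ->
  nth x0 w n = nth x0 w' n.
Proof.
move=> h h' e; have sz u : a + size t <= size u -> size (take a u) = a.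
  by move=> hu; rewrite size_takel //; lia.
move/eqP: e; rewrite eqseq_cat ?sz // => /andP[/eqP e1].
rewrite eqseq_cat // eqxx /= => /eqP e2 [na|na].
  by rewrite -(nth_take x0 na) e1 nth_take.
by rewrite -(subnKC na) -!nth_drop e2.
Qed.

(** * Presentations with a repeated factor *)

Section Counting.
Variables (A : finType) (k n : nat).
Local Notation I := ('I_k * bool)%type.
Implicit Types (p q : presentation A k) (i : I).
Variable len : presentation A k -> nat.
Hypothesis len_size : forall p q,
  (forall i, size (rel_word p i) = size (rel_word q i)) -> len p = len q.
Hypothesis len_le : forall p i, size (rel_word p i) <= len p.
Hypothesis finite_stratum : finite_set (stratum len n).
Hypothesis k_gt0 : 0 < k.

Definition unique_factors l p : Prop := forall i i' a a',
  a + l <= size (rel_word p i) -> a' + l <= size (rel_word p i') ->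
  take l (drop a (rel_word p i)) = take l (drop a' (rel_word p i')) -> i = i' /\ a = a'.

Definition repeated l p i a i' a' : Prop :=
  [/\ a + l <= size (rel_word p i), a' + l <= size (rel_word p i'),
      take l (drop a (rel_word p i)) = take l (drop a' (rel_word p i'))
    & i <> i' \/ (i = i' /\ a < a')].

Lemma not_unique_factors l p : ~ unique_factors l p ->
  exists i a i' a', repeated l p i a i' a'.
Proof.
move=> nu; apply: contrapT => h; apply: nu => i i' a a' s s' e.
have [ei|ni] := pselect (i = i'); last by case: h; exists i, a, i', a'; split=> //; left.
subst i'; split=> //; case: (ltngtP a a') => // lt; case: h.
  by exists i, a, i, a'; split=> //; right.
by exists i, a', i, a; split=> //; right.
Qed.

(* The overwritten factor is recovered from its other occurrence, from left to
   right if the two overlap. *)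
Lemma repeated_overwrite_inj l p q (t : seq A) i a i' a' : size t = l ->
  repeated l p i a i' a' -> repeated l q i a i' a' ->
  (forall x, x <> i' -> rel_word p x = rel_word q x) ->
  overwrite (rel_word p i') a' t = overwrite (rel_word q i') a' t -> p = q.
Proof.
move=> tl [sp sp' ep c] [sq sq' eq _] off e; apply: rel_word_inj => x.
have [->|nx] := pselect (x = i'); last exact: off.
rewrite -tl in sp' sq'.
have sz : size (rel_word p i') = size (rel_word q i').
  by rewrite -(size_overwrite sp') e size_overwrite.
(* A nonempty alphabet supplies the default letter for [nth]. *)
have [A0|a0] := posnP #|A|.
  have nil (w : seq A) : w = [::].
    by case: w => // b; have := fintype0 b; rewrite A0 => /(_ erefl).
  by rewrite (nil (rel_word p i')) (nil (rel_word q i')).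
have /card_gt0P[x0 _] : 0 < #|A| by [].
apply: (@eq_from_nth _ x0) => // m; elim/ltn_ind: m => m IH mp.
have [lt|ge] := ltnP m a'; first by apply: overwrite_nth e _ => //; left.
have [lt|ge'] := leqP (a' + l) m; first by apply: overwrite_nth e _ => //; right; rewrite tl.
have fac r0 : take l (drop a (rel_word r0 i)) = take l (drop a' (rel_word r0 i')) ->
    nth x0 (rel_word r0 i') m = nth x0 (rel_word r0 i) (a + (m - a')).
  move=> er; have := congr1 (fun s => nth x0 s (m - a')) er.
  by rewrite /= !nth_take ?nth_drop ?subnKC //; lia.
rewrite (fac p) // (fac q) //.
case: c => [ni|[ei lt]]; first by rewrite off.
by rewrite ei; apply: IH; lia.
Qed.

(** The square counts the recorded pairs of positions: a relation word and an offset of at most [n]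
    for each of the two occurrences. *)
Lemma count_repeated l :
  #|` fset_set [set p | stratum len n p /\ ~ unique_factors l p]| * #|A| ^ l <=
  (2 * k * n.+1) ^ 2 * #|` fset_set (stratum len n)|.
Proof.
pose W : finType := ((I * 'I_n.+1) * (I * 'I_n.+1))%type.
pose i0 : I := (Ordinal k_gt0, false).
have /choice[g gP] : forall p, exists w : W, stratum len n p /\ ~ unique_factors l p ->
    repeated l p w.1.1 w.1.2 w.2.1 w.2.2.
  move=> p.
  have [[Sp /not_unique_factors[i [a [i' [a' rep]]]]]|np] :=
    pselect (stratum len n p /\ ~ unique_factors l p); last first.
    by exists ((i0, ord0), (i0, ord0)).
  have [s s' _ _] := rep; have := len_le p i; have := len_le p i'.
  rewrite Sp => h' h; exists ((i, inord a), (i', inord a')) => _ /=.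
  by rewrite !inordK //; lia.
have cW : #|W| = (2 * k * n.+1) ^ 2.
  by rewrite !card_prod !card_ord card_bool; ring.
have cV : #|{: l.-tuple A}| = #|A| ^ l by rewrite card_tuple.
rewrite -cV -cW.
pose f p (t : l.-tuple A) := (g p, set_word p (g p).2.1 (overwrite (rel_word p (g p).2.1) (g p).2.2 t)).
apply: (@count_inj _ _ _ _ _ f) => //.
- by apply: sub_finite_set finite_stratum => p [].
- move=> p t [Sp nu] /=; apply: (etrans _ Sp); apply: len_size => i.
  rewrite rel_word_set; case: eqP => [->|//].
  by rewrite size_overwrite // size_tuple; have [] := gP p (conj Sp nu).
move=> p q t t' hp hq ef.
have eg : g p = g q := congr1 fst ef.
have es : set_word p (g p).2.1 (overwrite (rel_word p (g p).2.1) (g p).2.2 t) =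
    set_word q (g q).2.1 (overwrite (rel_word q (g q).2.1) (g q).2.2 t') := congr1 snd ef.
have rp := gP p hp; have rq := gP q hq; rewrite -eg in rq es.
have [_ sp _ _] := rp; have [_ sq _ _] := rq.
have ei := congr1 (fun x => rel_word x (g p).2.1) es.
rewrite /= !rel_word_set eqxx in ei.
have et : t = t' :> seq A.
  by rewrite -(overwriteK (size_tuple t) sp) ei (overwriteK (size_tuple t') sq).
split; last exact: val_inj.
apply: (repeated_overwrite_inj (size_tuple t) rp rq); last by rewrite ei et.
move=> x /eqP/negbTE nx; have := congr1 (fun y => rel_word y x) es.
by rewrite /= !rel_word_set nx.
Qed.

End Counting.

(** * Presentations with a short relation word *)

Section ShortWords.
Variables (A : finType) (k n D : nat).
Local Notation I := ('I_k * bool)%type.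
Implicit Types (p q : presentation A k) (i : I).
Hypothesis A_gt0 : 0 < #|A|.
Hypothesis k_gt0 : 0 < k.
Let M := n %/ (2 * k).
Hypothesis DM : D <= M.
Hypothesis D_gt0 : 0 < D.

Definition has_short p : Prop := exists i, size (rel_word p i) < D.

Let i0 : I := (Ordinal k_gt0, false).
Let d0 : 'I_D := Ordinal D_gt0.

Lemma card_index : #|{: I}| = 2 * k.
Proof. by rewrite card_prod card_ord card_bool mulnC. Qed.

Lemma M_bound : 2 * k * M <= n.
Proof. by rewrite mulnC leq_trunc_div. Qed.

Lemma max_length_le p i : size (rel_word p i) <= max_length p.
Proof. by rewrite max_lengthE (leq_bigmax (F := fun i => size (rel_word p i))). Qed.

Lemma sum_length_le p i : size (rel_word p i) <= sum_length p.
Proof. by rewrite sum_lengthE (bigD1 i) //= leq_addr. Qed.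

(** Appending fewer than [M] letters to a word shorter than [D] keeps its length below
    [D + M <= 2 * M <= n], and a longest word, not being short, is unchanged. The recorded old
    length shows where the appended letters begin. *)
Lemma count_short_max :
  #|` fset_set [set p | stratum (@max_length A k) n p /\ has_short p]| * M <=
  (2 * k) ^ 2 * D * #|` fset_set (stratum (@max_length A k) n)|.
Proof.
have [a0 _] := card_gt0P A_gt0.
pose W : finType := (I * 'I_D)%type.
have /choice[g gP] : forall p, exists w : W, stratum (@max_length A k) n p /\ has_short p ->
    size (rel_word p w.1) = w.2.
  move=> p; have [[i h]|nh] := pselect (has_short p); last by exists (i0, d0) => -[].
  by exists (i, Ordinal h).
(* One factor [2 * k] is given away so that both stratifications share the same bound. *)
apply: leq_trans (_ : #|W| * #|` fset_set (stratum (@max_length A k) n)| <= _); last first.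
  rewrite leq_mul2r; apply/orP; right; rewrite card_prod card_ord card_index.
  by rewrite leq_mul2r; apply/orP; right; rewrite -{1}[2 * k]expn1 leq_pexp2l //; lia.
rewrite -{1}[M]card_ord.
pose f p (t : 'I_M) := (g p, set_word p (g p).1 (rel_word p (g p).1 ++ nseq t a0)).
apply: (@count_inj _ _ _ _ _ f).
- by apply: sub_finite_set (finite_stratum_max A k n) => p [].
- exact: finite_stratum_max.
- move=> p t [Sp hp]; rewrite /f /stratum /=.
  have sz := gP p (conj Sp hp); have lt := ltn_ord (g p).2; have ltt := ltn_ord t.
  have Mn : M + M <= n by apply: leq_trans M_bound; nia.
  apply/eqP; rewrite eqn_leq; apply/andP; split.
    rewrite max_lengthE; apply/bigmax_leqP => i _; rewrite rel_word_set.
    case: eqP => _; last by rewrite -Sp max_length_le.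
    by rewrite size_cat size_nseq sz; lia.
  have [i1 e1] := max_attained p k_gt0; rewrite Sp in e1.
  rewrite -[X in X <= _]e1.
  have := max_length_le (set_word p (g p).1 (rel_word p (g p).1 ++ nseq t a0)) i1.
  rewrite rel_word_set; case: eqP => // ei; move: e1; rewrite ei sz; lia.
move=> p q t t' hp hq ef.
have eg : g p = g q := congr1 fst ef.
have es : set_word p (g p).1 (rel_word p (g p).1 ++ nseq t a0) =
  set_word q (g q).1 (rel_word q (g q).1 ++ nseq t' a0) := congr1 snd ef.
have sp := gP p hp; have sq := gP q hq; rewrite -eg in sq es.
have := congr1 (fun x => rel_word x (g p).1) es; rewrite /= !rel_word_set eqxx => /eqP.
rewrite eqseq_cat ?sp ?sq // => /andP[/eqP ew /eqP/(congr1 size)].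
rewrite !size_nseq => et; split; last exact: val_inj.
apply: rel_word_inj => x; have [-> //|nx] := eqVneq x (g p).1.
by have := congr1 (fun y => rel_word y x) es; rewrite /= !rel_word_set (negbTE nx).
Qed.

Lemma long_word p : sum_length p = n -> exists i, M <= size (rel_word p i).
Proof.
move=> e; have I0 : 0 < #|{: I}| by rewrite card_index; lia.
have [i1 e1] := eq_bigmax (fun i => size (rel_word p i)) I0; exists i1.
have le : n <= 2 * k * size (rel_word p i1).
  rewrite -e sum_lengthE -card_index -sum_nat_const; apply: leq_sum => i _.
  by rewrite -e1 (leq_bigmax (F := fun i => size (rel_word p i))).
by rewrite /M -(leq_pmul2l (m := 2 * k)) ?(leq_trans M_bound) //; lia.
Qed.

(** To keep the sum, the added letters are moved from the beginning of a word of length at least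
    [M], the average length rounded down. Cutting the lengthened word at its recorded old length
    gives them back. *)
Lemma count_short_sum :
  #|` fset_set [set p | stratum (@sum_length A k) n p /\ has_short p]| * M <=
  (2 * k) ^ 2 * D * #|` fset_set (stratum (@sum_length A k) n)|.
Proof.
pose W : finType := (I * I * 'I_D)%type.
have /choice[g gP] : forall p, exists w : W, stratum (@sum_length A k) n p /\ has_short p ->
    size (rel_word p w.1.1) = w.2 /\ M <= size (rel_word p w.1.2).
  move=> p; have [[Sp [i h]]|nh] := pselect (stratum (@sum_length A k) n p /\ has_short p);
    last by exists (i0, i0, d0).
  by have [i' h'] := long_word Sp; exists (i, i', Ordinal h).
have cW : #|W| = (2 * k) ^ 2 * D by rewrite !card_prod !card_ord card_bool; ring.
rewrite -{1}[M]card_ord -cW.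
pose f p (t : 'I_M) := let: w := g p in
  (w, set_word (set_word p w.1.1 (rel_word p w.1.1 ++ take t (rel_word p w.1.2)))
    w.1.2 (drop t (rel_word p w.1.2))).
have neq p : stratum (@sum_length A k) n p /\ has_short p -> ((g p).1.1 == (g p).1.2) = false.
  move=> hp; have [h1 h2] := gP p hp; apply/negbTE/eqP => e; move: h2; rewrite -e h1.
  by have := ltn_ord (g p).2; lia.
apply: (@count_inj _ _ _ _ _ f).
- by apply: sub_finite_set (finite_stratum_sum A k n) => p [].
- exact: finite_stratum_sum.
- move=> p t hp; rewrite /f /stratum /=; have [h1 h2] := gP p hp; have ne := neq p hp.
  have ltt := ltn_ord t; rewrite -hp.1 !sum_lengthE.
  rewrite (bigD1 (g p).1.1) // (bigD1 (g p).1.2) /=; last by rewrite eq_sym ne.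
  rewrite [RHS](bigD1 (g p).1.1) // [X in _ = _ + X](bigD1 (g p).1.2) /=; last by rewrite eq_sym ne.
  rewrite !rel_word_set !eqxx ne addnA [RHS]addnA; congr (_ + _).
    have ht := leq_trans (ltnW ltt) h2.
    by rewrite size_cat size_takel // size_drop -addnA subnKC.
  by apply: eq_bigr => i /andP[/negbTE n1 /negbTE n2]; rewrite !rel_word_set n1 n2.
move=> p q t t' hp hq ef.
have eg : g p = g q := congr1 fst ef.
have es := congr1 snd ef; rewrite [LHS]/= [RHS]/= in es.
have [sp lp] := gP p hp; have [sq lq] := gP q hq; have ne := neq p hp.
rewrite -eg in sq lq es.
have ltt := ltn_ord t; have ltt' := ltn_ord t'.
have := congr1 (fun x => rel_word x (g p).1.1) es; rewrite /= !rel_word_set ne eqxx => /eqP.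
rewrite eqseq_cat ?sp ?sq // => /andP[/eqP ew /eqP ew'].
have et : t = t' :> nat.
  by have := congr1 size ew'; rewrite !size_takel //; apply: leq_trans (ltnW _) _; eassumption.
have := congr1 (fun x => rel_word x (g p).1.2) es; rewrite /= !rel_word_set eqxx => ed.
split; last exact: val_inj.
apply: rel_word_inj => x; have [-> //|n1] := eqVneq x (g p).1.1.
have [->|n2] := eqVneq x (g p).1.2.
  by rewrite -(cat_take_drop t (rel_word p _)) ew' ed cat_take_drop.
have := congr1 (fun y => rel_word y x) es.
by rewrite /= !rel_word_set (negbTE n1) (negbTE n2).
Qed.

End ShortWords.

(** * Density of the exceptional presentations *)

Import Order.TTheory GRing.Theory Num.Theory numFieldNormedType.Exports.

Definition small_overlap (A : finType) (k : nat) (p : presentation A k) : Prop :=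
  exists l, [/\ 0 < l, forall i, 4 * l <= size (rel_word p i) & unique_factors l p].

Lemma exp2_ge m : m * m.+1 <= 2 * 2 ^ m.
Proof.
elim: m => // m IH; have lt := ltn_expl m (isT : 1 < 2).
by rewrite expnS; nia.
Qed.

Section Density.
Variables (A : finType) (k : nat) (len : presentation A k -> nat).
Hypothesis A_ge2 : 1 < #|A|.
Hypothesis k_gt0 : 0 < k.
Hypothesis len_strat : len = @sum_length A k \/ len = @max_length A k.

Lemma finite_stratum n : finite_set (stratum len n).
Proof. by case: len_strat => ->; [exact: finite_stratum_sum|exact: finite_stratum_max]. Qed.

Lemma len_size (p q : presentation A k) :
  (forall i, size (rel_word p i) = size (rel_word q i)) -> len p = len q.
Proof.
by case: len_strat => -> e; rewrite ?sum_lengthE ?max_lengthE; apply: eq_bigr => i _.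
Qed.

Lemma len_le (p : presentation A k) i : size (rel_word p i) <= len p.
Proof. by case: len_strat => ->; [exact: sum_length_le|exact: max_length_le]. Qed.

Lemma stratum_nonempty n : 0 < #|` fset_set (stratum len n)|.
Proof.
have /card_gt0P[a0 _] : 0 < #|A| by exact: ltnW.
pose i0 : 'I_k * bool := (Ordinal k_gt0, false).
pose p0 : presentation A k := [tuple ([::] : word A, [::] : word A) | j < k].
have e0 i : rel_word p0 i = [::] by rewrite /rel_word tnth_mktuple; case: i.2.
pose p := set_word p0 i0 (nseq n a0).
have e i : rel_word p i = if i == i0 then nseq n a0 else [::] by rewrite rel_word_set e0.
have Sp : len p = n.
  case: len_strat => ->; rewrite ?sum_lengthE ?max_lengthE (bigD1 i0) //= e eqxx size_nseq.
    by rewrite big1 ?addn0 // => i /negbTE ne; rewrite e ne.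
  rewrite (_ : \max_(_ | _) _ = 0) ?maxn0 //; apply/eqP; rewrite -leqn0.
  by apply/bigmax_leqP => i /negbTE ne; rewrite e ne.
rewrite cardfs_gt0; apply/fset0Pn; exists p.
by rewrite in_fset_set ?inE //; exact: finite_stratum.
Qed.

Lemma count_short n D : D <= n %/ (2 * k) -> 0 < D ->
  #|` fset_set [set p | stratum len n p /\ has_short D p]| * (n %/ (2 * k)) <=
  (2 * k) ^ 2 * D * #|` fset_set (stratum len n)|.
Proof.
move=> DM D0; have A0 := ltnW A_ge2.
by case: len_strat => ->; [exact: count_short_sum|exact: count_short_max].
Qed.

Lemma count_not_small_overlap n m : 2 ^ m <= n -> n < 2 ^ m.+1 -> 96 * k <= m ->
  #|` fset_set (stratum len n `&` ~` [set p | small_overlap p])| * m <=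
  (4 * k ^ 2 + 384 * k ^ 3) * #|` fset_set (stratum len n)|.
Proof.
move=> nm nm' km; set s := #|` fset_set (stratum len n)|.
(* This [l] gives [#|A| ^ l >= 2 ^ l >= n.+1 ^ 3], one power of [n.+1] more than the pairs of
   positions cost in [count_repeated]. *)
pose l := 3 * m.+1; pose q := n %/ (2 * k).
pose B1 := [set p | stratum len n p /\ ~ unique_factors l p].
pose B2 := [set p | stratum len n p /\ has_short (4 * l) p].
have fin (B : set (presentation A k)) : finite_set [set p | stratum len n p /\ B p].
  by apply: sub_finite_set (finite_stratum n) => p [].
have mn : m <= n by apply: leq_trans nm; exact/ltnW/ltn_expl.
(* The left side is at most [2 * 2 ^ m <= 2 * n], and [n < 2 * k * q.+1 <= 4 * k * q]. *)
have mq : m * m.+1 <= 8 * k * q.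
  have h1 := exp2_ge m; have h2 := divn_eq n (2 * k).
  have h3 : n %% (2 * k) < 2 * k by rewrite ltn_mod; lia.
  have q0 : 0 < q by rewrite divn_gt0; lia.
  rewrite -/q in h2; nia.
(* The threshold [96 * k] arises here as [8 * k] times the 12 in [4 * l = 12 * m.+1]. *)
have Dq : 4 * l <= q.
  rewrite -(leq_pmul2l (m := 8 * k)); last by lia.
  by apply: leq_trans mq; rewrite /l; nia.
have b1 : #|` fset_set B1| * m <= 4 * k ^ 2 * s.
  have h := count_repeated len_size len_le (finite_stratum n) k_gt0 l.
  have hA : n.+1 ^ 3 <= #|A| ^ l.
    apply: leq_trans (_ : 2 ^ l <= _); last by rewrite leq_exp2r // muln_gt0.
    by rewrite /l mulnC expnM leq_exp2r.
  have h' : #|` fset_set B1| * n.+1 <= 4 * k ^ 2 * s.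
    rewrite -(leq_pmul2r (m := n.+1 ^ 2)) ?expn_gt0 // -mulnA -expnS.
    apply: leq_trans (leq_mul (leqnn _) hA) (leq_trans h _).
    by rewrite -/s !expnMn; nia.
  apply: leq_trans h'; rewrite leq_mul2l; apply/orP; right; exact: leqW.
(* The constant is [4 * 12 * 8], from the square of [2 * k], from [4 * l = 12 * m.+1] and from
   [mq]. *)
have b2 : #|` fset_set B2| * m <= 384 * k ^ 3 * s.
  have h := @count_short n (4 * l) Dq isT; rewrite -/s -/q -/B2 in h.
  rewrite -(leq_pmul2r (m := m.+1)) // -mulnA.
  apply: leq_trans (leq_mul (leqnn _) mq) _.
  have := leq_mul (leqnn (8 * k)) h.
  rewrite /l; set b := #|` _|; set t := m.+1; clearbody b t s q => h''.
  have -> : b * (8 * k * q) = 8 * k * (b * q) by ring.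
  apply: leq_trans h'' _; rewrite leq_eqVlt; apply/orP; left; apply/eqP; ring.
have sub : (fset_set (stratum len n `&` ~` [set p | small_overlap p])
    `<=` fset_set B1 `|` fset_set B2)%fset.
  rewrite -fset_setU; [|exact: fin|exact: fin].
  rewrite -fset_set_sub; [|by apply: sub_finite_set (finite_stratum n) => p []|by rewrite finite_setU; split; exact: fin].
  move=> p [Sp ns]; have [sh|nsh] := pselect (has_short (4 * l) p); first by right.
  left; split=> // u; apply: ns; exists l; split=> // i.
  by rewrite leqNgt; apply/negP => h; apply: nsh; exists i.
rewrite mulnDl; apply: leq_trans (leq_add b1 b2); rewrite -mulnDl leq_mul2r; apply/orP; right.
exact: leq_trans (fsubset_leq_card sub) (leq_card_fsetU _ _).
Qed.

End Density.

Lemma generic_small_overlap (R : realType) (A : finType) (k : nat) (len : presentation A k -> nat) :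
  1 < #|A| -> 0 < k -> len = @sum_length A k \/ len = @max_length A k ->
  generic R len [set p | small_overlap p].
Proof.
move=> A_ge2 k_gt0 len_strat; rewrite /generic.
set X := [set p | small_overlap p]; pose c := 4 * k ^ 2 + 384 * k ^ 3.
apply/cvgrPdist_le => /= e e0.
(* For [n >= 2 ^ M] the logarithm [m] is at least [M], so the counting bound is available and the
   exceptional density is at most [c / m <= e]. *)
pose M := maxn (96 * k) (Num.bound (c%:R / e : R)).+1.
exists (2 ^ M) => // n /= Mn.
have n0 : 0 < n by apply: leq_trans Mn; rewrite expn_gt0.
pose m := trunc_log 2 n.
have Mm : M <= m by rewrite -(trunc_expnK M (isT : 1 < 2)) leq_trunc_log.
have [h1 h2] := andP (trunc_log_bounds (isT : 1 < 2) n0).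
have km : 96 * k <= m by apply: leq_trans Mm; exact: leq_maxl.
have bm := count_not_small_overlap A_ge2 k_gt0 len_strat h1 h2 km.
rewrite -/X -/c in bm; have fin := finite_stratum len_strat n.
have s0 := stratum_nonempty A_ge2 k_gt0 len_strat n.
have finX : finite_set (X `&` stratum len n) by apply: sub_finite_set fin => p [].
have finC : finite_set (stratum len n `&` ~` X) by apply: sub_finite_set fin => p [].
have split_card : #|` fset_set (stratum len n)| =
    #|` fset_set (X `&` stratum len n)| + #|` fset_set (stratum len n `&` ~` X)|.
  rewrite -cardfsUI -fset_setU // -fset_setI //.
  rewrite (_ : (X `&` stratum len n) `&` (stratum len n `&` ~` X) = set0).
    by rewrite fset_set0 cardfs0 addn0 (setIC (stratum len n)) -setIUl setUv setTI.
  by apply/seteqP; split=> p // [[Xp _] [_ /(_ Xp)]].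
move: bm s0; rewrite split_card.
set x := #|` fset_set (X `&` _)|; set b := #|` _| => bm s0.
have s0' : (0 < (x + b)%:R :> R)%R by rewrite ltr0n.
have -> : (1 - x%:R / (x + b)%:R = b%:R / (x + b)%:R :> R)%R.
  by rewrite -[X in (X - _)%R](divff (lt0r_neq0 s0')) -mulrBl natrD addrAC subrr add0r.
rewrite ger0_norm ?divr_ge0 // ler_pdivrMr //.
have m0 : 0 < m by apply: leq_trans Mm; rewrite leq_max orbT.
have m0' : (0 < m%:R :> R)%R by rewrite ltr0n.
rewrite -(ler_pM2r m0').
have cm : (c%:R <= e * m%:R :> R)%R.
  rewrite -ler_pdivrMl // mulrC; apply: ltW.
  apply: lt_le_trans (archi_boundP _) _; first by rewrite divr_ge0 // ltW.
  by rewrite ler_nat; apply: leq_trans Mm; rewrite leq_max leqnSn orbT.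
apply: le_trans (_ : (c%:R * (x + b)%:R <= _ :> R)%R).
  by rewrite -!natrM ler_nat.
by rewrite mulrAC ler_pM2r.
Qed.

(** * The main theorem *)

Lemma pres_cong_rel_word (A : finType) (k : nat) (p : presentation A k) i :
  pres_cong p (rel_word p i) (rel_word p (bar i)).
Proof.
have h : pres_cong p (tnth p i.1).1 (tnth p i.1).2.
  by apply: pres_cong_rel; rewrite -surjective_pairing mem_tnth.
by rewrite /rel_word; case: i h => j [] /= h //; exact: pres_cong_sym.
Qed.

Lemma small_overlap_properties (A : finType) (k : nat) (p : presentation A k) :
  small_overlap p ->
  rational_monoid (pres_monoid p) /\
  asynchronous_automatic (pres_monoid p) /\
  word_hyperbolic (pres_monoid p) /\
  kleene_analogue (pres_monoid p) /\
  boolean_algebra_of_rational_subsets (pres_monoid p) /\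
  decidable_rational_subset_membership (pres_monoid p).
Proof.
move=> [l [l0 long uniq]].
pose beta (w : word A) : word A := normal (rel_word p) l 0 (inl None) w.
have sigma_morph : surjective_morphism (pres_pi p).
  by split; [exact: pres_pi_morphism|exact: pres_pi_surj].
have trans : transduction (fun u v => v = beta u) := normal_transduction l0 long.
have sigma_beta w : pres_pi p (beta w) = pres_pi p w.
  apply/pres_piP.
  apply: (normal_sound l0 long uniq (E := pres_cong p) _ _ _ _ _ (inl None)).
  - exact: pres_cong_refl.
  - exact: pres_cong_sym.
  - exact: pres_cong_trans.
  - by move=> u u' v v'; exact: pres_cong_mul.
  - exact: pres_cong_rel_word.
have bar_eq h i y : beta (h ++ rel_word p i ++ y) = beta (h ++ rel_word p (bar i) ++ y).
  exact: (normal_bar l0 long uniq (m := inl None)).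
(* Quantifying over the context carries the induction through products, whose factors are replaced
   one after the other. *)
have cong_eq u v : pres_cong p u v -> forall h y, beta (h ++ u ++ y) = beta (h ++ v ++ y).
  elim=> {u v} [u v|//|u v _ IH h y|u v w _ IH1 _ IH2 h y|u u' v v' _ IH1 _ IH2 h y].
  - move=> /tnthP[j e] h y; have := bar_eq h (j, false) y.
    by rewrite /rel_word /= -e.
  - by rewrite IH.
  - by rewrite IH1.
  - rewrite -[(u * v)%g]/(u ++ v) -[(u' * v')%g]/(u' ++ v') -!catA IH1.
    by rewrite catA IH2 -catA.
have beta_sigma u v : pres_pi p u = pres_pi p v -> beta u = beta v.
  by move=> /pres_piP/cong_eq/(_ [::] [::]); rewrite /= !cats0.
split; first exact: rational_rational_monoid sigma_morph trans sigma_beta beta_sigma.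
split; first exact: rational_asynchronous sigma_morph trans sigma_beta beta_sigma.
split; first exact: rational_word_hyperbolic sigma_morph trans sigma_beta beta_sigma.
split; first exact: rational_kleene sigma_morph trans sigma_beta beta_sigma.
split; first exact: rational_boolean sigma_morph trans sigma_beta beta_sigma.
exact: rational_decidable sigma_morph trans sigma_beta beta_sigma.
Qed.

Theorem theorem9 (R : realType) (A : finType) (k : nat)
    (A_ge2 : (2 <= #|A|)%N) (k_gt0 : (0 < k)%N)
    (len : presentation A k -> nat)
    (len_strat : len = @sum_length A k \/ len = @max_length A k) :
  generic_presentation_has R len (fun p =>
    rational_monoid (pres_monoid p) /\
    asynchronous_automatic (pres_monoid p) /\
    word_hyperbolic (pres_monoid p) /\
    kleene_analogue (pres_monoid p) /\
    boolean_algebra_of_rational_subsets (pres_monoid p) /\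
    decidable_rational_subset_membership (pres_monoid p)).
Proof.
exists [set p | small_overlap p]; split; first exact: generic_small_overlap.
exact: small_overlap_properties.
Qed.
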